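(* Let $M$ be a term of the CCV $\lambda\mu$-calculus. Then $M$ is normalizable (i.e., $M\to^* M'$ for some $M'$ containing no redex of any reduction rule) if and only if its CPS translation $[\![M]\!]$ has a $\beta\eta$-normal form in the target calculus.
   Context: CCV $\lambda\mu$-calculus. Ordinary variables $x,y,z,\dots$ and continuation variables $k,l,\dots$ are disjoint. Terms $M ::= x \mid \lambda x.M \mid MM \mid (M\ \mathsf{where}\ x:=M) \mid \mu k.J$, jumps $J ::= [k]M \mid (J\ \mathsf{where}\ x:=M)$, where $(L\ \mathsf{where}\ x:=M)$ means $\mathsf{let}\ x=M\ \mathsf{in}\ L$ ($x$ bound in $L$ only); $\lambda x$, $\mu k$ bind as usual. Terms are identified up to $\alpha$-conversion and the congruence generated by (E1) $(L\ \mathsf{where}\ x:=(M\ \mathsf{where}\ y:=N))=((L\ \mathsf{where}\ x:=M)\ \mathsf{where}\ y:=N)$ if $y$ not free in $L$; (E2) $((\mu k.J)\ \mathsf{where}\ x:=M)=\mu k.(J\ \mathsf{where}\ x:=M)$ if $k$ not free in $M$; (E3) $[k](L\ \mathsf{where}\ x:=M)=([k]L\ \mathsf{where}\ x:=M)$. Values $V$: variables and $\lambda$-abstractions; $N$ denotes a non-value. Reduction rules ($z$ fresh): $NM\to(zM\ \mathsf{where}\ z:=N)$; $VN\to(Vz\ \mathsf{where}\ z:=N)$; $(\lambda x.M)V\to(M\ \mathsf{where}\ x:=V)$; $(M\ \mathsf{where}\ x:=V)\to M\{V/x\}$; $(M\ \mathsf{where}\ x:=\mu k.J)\to\mu k.J\{[k]\square\mapsto[k](M\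 \mathsf{where}\ x:=\square)\}$; $[l]\mu k.J\to J\{l/k\}$; $\lambda x.Vx\to V$ ($x$ not free in $V$); $(x\ \mathsf{where}\ x:=M)\to M$; $\mu k.[k]M\to M$ ($k$ not free in $M$). The context substitution replaces recursively each subjump $[k]Q$ with $k$ free by $[k](M\ \mathsf{where}\ x:=Q)$; $J\{l/k\}$ replaces each such $[k]Q$ by $[l]Q$. $\to$ is the compatible closure. Target calculus: sorted $\lambda$-calculus $T::=\lambda k.Q\mid WW$, $Q::=KW\mid TK$, $W::=x\mid\lambda x.T$, $K::=k\mid\lambda x.Q$ with $\beta\eta$-reduction. CPS translation: $\langle V\rangle[K]=KV^*$; $\langle V_1V_2\rangle[K]=V_1^*V_2^*K$; $\langle VN\rangle[K]=\langle N\rangle[\lambda y.V^*yK]$; $\langle NV\rangle[K]=\langle N\rangle[\lambda x.xV^*K]$; $\langle N_1N_2\rangle[K]=\langle N_1\rangle[\lambda x.\langle N_2\rangle[\lambda y.xyK]]$; $\langle (L\ \mathsf{where}\ x:=M)\rangle[K]=\langle M\rangle[\lambda x.\langle L\rangle[K]]$ (renaming $x$ if free in $K$); $\langle\mu k.J\rangle[K]=(\lambda k.\langle J\rangle)K$; $\langle[k]M\rangle=\langle M\rangle[k]$; $\langle (J\ \mathsf{where}\ x:=M)\rangle=\langle M\rangle[\lambda x.\langle J\rangle]$; $x^*=x$; $(\lambda x.M)^*=\lambda xk.\langle M\rangle[k]$; $[\![M]\!]=\lambda k.\langle M\rangle[k]$ (fresh bound variables). $[\![M]\!]$ is computed from any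 syntax-tree representative of $M$ (the result is determined up to $\beta$-equality). *)

(* Defs.v *)
(* CCV lambda-mu calculus, its CPS translation, and the
   target lambda-calculus with beta-eta reduction.  De Bruijn indices are used,
   with two SEPARATE index spaces: ordinary variables (bound by [Lam] and by
   the body of [Wh]/[JWh]) and continuation variables (bound by [Mu]).
   Alpha-conversion is thus syntactic identity. *)
From Stdlib Require Import Relations Arith.

Inductive tm : Type :=
| Var : nat -> tm
| Lam : tm -> tm                  (* \x. M, x = ord. index 0 in M *)
| App : tm -> tm -> tm
| Wh  : tm -> tm -> tm            (* Wh L M = (L where x := M), x bound in L only *)
| Mu  : jmp -> tm                 (* mu k. J, k = cont. index 0 in J *)
with jmp : Type :=
| Jmp : nat -> tm -> jmp          (* [k] M, k continuation variable *)
| JWh : jmp -> tm -> jmp.         (* (J where x := M), x bound in J only *)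

Definition scons {A : Type} (a : A) (f : nat -> A) (n : nat) : A :=
  match n with 0 => a | S m => f m end.

Definition upr (f : nat -> nat) : nat -> nat := scons 0 (fun m => S (f m)).

Fixpoint oren (f : nat -> nat) (M : tm) : tm :=
  match M with
  | Var n => Var (f n)
  | Lam B => Lam (oren (upr f) B)
  | App A B => App (oren f A) (oren f B)
  | Wh L N => Wh (oren (upr f) L) (oren f N)
  | Mu J => Mu (orenj f J)
  end
with orenj (f : nat -> nat) (J : jmp) : jmp :=
  match J with
  | Jmp k Q => Jmp k (oren f Q)
  | JWh J' N => JWh (orenj (upr f) J') (oren f N)
  end.

Fixpoint cren (f : nat -> nat) (M : tm) : tm :=
  match M with
  | Var n => Var n
  | Lam B => Lam (cren f B)
  | App A B => App (cren f A) (cren f B)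
  | Wh L N => Wh (cren f L) (cren f N)
  | Mu J => Mu (crenj (upr f) J)
  end
with crenj (f : nat -> nat) (J : jmp) : jmp :=
  match J with
  | Jmp k Q => Jmp (f k) (cren f Q)
  | JWh J' N => JWh (crenj f J') (cren f N)
  end.

Definition olift (M : tm) : tm := oren S M.
Definition clift (M : tm) : tm := cren S M.

Definition ups (s : nat -> tm) : nat -> tm := scons (Var 0) (fun m => olift (s m)).

Fixpoint osub (s : nat -> tm) (M : tm) : tm :=
  match M with
  | Var n => s n
  | Lam B => Lam (osub (ups s) B)
  | App A B => App (osub s A) (osub s B)
  | Wh L N => Wh (osub (ups s) L) (osub s N)
  | Mu J => Mu (osubj (fun n => clift (s n)) J)
  end
with osubj (s : nat -> tm) (J : jmp) : jmp :=
  match J with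
  | Jmp k Q => Jmp k (osub s Q)
  | JWh J' N => JWh (osubj (ups s) J') (osub s N)
  end.

Definition isval (M : tm) : bool :=
  match M with Var _ | Lam _ => true | _ => false end.

(* Context substitution  J{[k] [] |-> [k](M where x := [])}, recursively.
   [c] is the current index of k; [M] has x as ordinary index 0. *)
Fixpoint ctxt (c : nat) (M : tm) (P : tm) : tm :=
  match P with
  | Var n => Var n
  | Lam B => Lam (ctxt c (oren (upr S) M) B)
  | App A B => App (ctxt c M A) (ctxt c M B)
  | Wh L N => Wh (ctxt c (oren (upr S) M) L) (ctxt c M N)
  | Mu J => Mu (ctxj (S c) (clift M) J)
  end
with ctxj (c : nat) (M : tm) (J : jmp) : jmp :=
  match J with
  | Jmp k Q => if Nat.eqb k c then Jmp k (Wh M (ctxt c M Q))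
               else Jmp k (ctxt c M Q)
  | JWh J' N => JWh (ctxj c (oren (upr S) M) J') (ctxt c M N)
  end.

(* J{l/k} for k = continuation index 0 of J, l free outside *)
Definition csubst0 (l : nat) (J : jmp) : jmp := crenj (scons l (fun m => m)) J.

Inductive eax : tm -> tm -> Prop :=
| E1 : forall L M N, eax (Wh L (Wh M N)) (Wh (Wh (oren (upr S) L) M) N)
| E2 : forall J M, eax (Wh (Mu J) M) (Mu (JWh J (clift M))).

Inductive eaxj : jmp -> jmp -> Prop :=
| E1j : forall J M N, eaxj (JWh J (Wh M N)) (JWh (JWh (orenj (upr S) J) M) N)
| E3 : forall k L M, eaxj (Jmp k (Wh L M)) (JWh (Jmp k L) M).

Inductive ec : tm -> tm -> Prop :=
| ec_ax : forall M N, eax M N -> ec M N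
| ec_lam : forall M N, ec M N -> ec (Lam M) (Lam N)
| ec_appl : forall M M' N, ec M M' -> ec (App M N) (App M' N)
| ec_appr : forall M N N', ec N N' -> ec (App M N) (App M N')
| ec_whl : forall L L' N, ec L L' -> ec (Wh L N) (Wh L' N)
| ec_whr : forall L N N', ec N N' -> ec (Wh L N) (Wh L N')
| ec_mu : forall J J', ecj J J' -> ec (Mu J) (Mu J')
with ecj : jmp -> jmp -> Prop :=
| ecj_ax : forall J J', eaxj J J' -> ecj J J'
| ecj_jmp : forall k M M', ec M M' -> ecj (Jmp k M) (Jmp k M')
| ecj_whl : forall J J' N, ecj J J' -> ecj (JWh J N) (JWh J' N)
| ecj_whr : forall J N N', ec N N' -> ecj (JWh J N) (JWh J N').

Definition teq : relation tm := clos_refl_sym_trans tm ec.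

Inductive rtop : tm -> tm -> Prop :=
| R_appN : forall N M, isval N = false ->
    rtop (App N M) (Wh (App (Var 0) (olift M)) N)
| R_appV : forall V N, isval V = true -> isval N = false ->
    rtop (App V N) (Wh (App (olift V) (Var 0)) N)
| R_beta : forall M V, isval V = true -> rtop (App (Lam M) V) (Wh M V)
| R_whV : forall M V, isval V = true -> rtop (Wh M V) (osub (scons V Var) M)
| R_whMu : forall M J, rtop (Wh M (Mu J)) (Mu (ctxj 0 (clift M) J))
| R_eta : forall V, isval V = true -> rtop (Lam (App (olift V) (Var 0))) V
| R_whx : forall M, rtop (Wh (Var 0) M) M
| R_mu : forall M, rtop (Mu (Jmp 0 (clift M))) M.

Inductive rjtop : jmp -> jmp -> Prop :=
| R_jmu : forall l J, rjtop (Jmp l (Mu J)) (csubst0 l J).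

Inductive step : tm -> tm -> Prop :=
| s_top : forall M N, rtop M N -> step M N
| s_lam : forall M N, step M N -> step (Lam M) (Lam N)
| s_appl : forall M M' N, step M M' -> step (App M N) (App M' N)
| s_appr : forall M N N', step N N' -> step (App M N) (App M N')
| s_whl : forall L L' N, step L L' -> step (Wh L N) (Wh L' N)
| s_whr : forall L N N', step N N' -> step (Wh L N) (Wh L N')
| s_mu : forall J J', stepj J J' -> step (Mu J) (Mu J')
with stepj : jmp -> jmp -> Prop :=
| sj_top : forall J J', rjtop J J' -> stepj J J'
| sj_jmp : forall k M M', step M M' -> stepj (Jmp k M) (Jmp k M')
| sj_whl : forall J J' N, stepj J J' -> stepj (JWh J N) (JWh J' N)
| sj_whr : forall J N N', step N N' -> stepj (JWh J N) (JWh J N').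

Definition red (M N : tm) : Prop :=
  exists M' N', teq M M' /\ step M' N' /\ teq N' N.

Definition src_normal (M : tm) : Prop := ~ exists N, red M N.

Definition normalizable (M : tm) : Prop :=
  exists M', clos_refl_trans tm red M M' /\ src_normal M'.

Inductive lt : Type :=
| lvar : nat -> lt
| llam : lt -> lt
| lapp : lt -> lt -> lt.

Fixpoint lren (f : nat -> nat) (T : lt) : lt :=
  match T with
  | lvar n => lvar (f n)
  | llam B => llam (lren (upr f) B)
  | lapp A B => lapp (lren f A) (lren f B)
  end.

Definition lsh (T : lt) : lt := lren S T.

Definition lups (s : nat -> lt) : nat -> lt := scons (lvar 0) (fun m => lsh (s m)).

Fixpoint lsub (s : nat -> lt) (T : lt) : lt :=
  match T with
  | lvar n => s n
  | llam B => llam (lsub (lups s) B)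
  | lapp A B => lapp (lsub s A) (lsub s B)
  end.

Inductive lstep : lt -> lt -> Prop :=
| l_beta : forall B N, lstep (lapp (llam B) N) (lsub (scons N lvar) B)
| l_eta : forall F, lstep (llam (lapp (lsh F) (lvar 0))) F
| l_lam : forall A B, lstep A B -> lstep (llam A) (llam B)
| l_appl : forall A A' B, lstep A A' -> lstep (lapp A B) (lapp A' B)
| l_appr : forall A B B', lstep B B' -> lstep (lapp A B) (lapp A B').

Definition lnormal (T : lt) : Prop := ~ exists T', lstep T T'.

Definition has_nf (T : lt) : Prop :=
  exists T', clos_refl_trans lt lstep T T' /\ lnormal T'.

(* CPS translation.  [so]/[sk] map free ordinary / continuation
   variables of the source to target terms (variables); [K] is the
   continuation argument.  [cps M so sk K] = <M>[K], [star V] = V*,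
   [cpsj J] = <J>. *)

Definition shf (s : nat -> lt) : nat -> lt := fun n => lsh (s n).
Definition shf2 (s : nat -> lt) : nat -> lt := fun n => lren (fun m => S (S m)) (s n).

Fixpoint cps (M : tm) (so sk : nat -> lt) (K : lt) {struct M} : lt :=
  match M with
  | Var n => lapp K (so n)
  | Lam B => lapp K (llam (llam (cps B (scons (lvar 1) (shf2 so)) (shf2 sk) (lvar 0))))
  | App M1 M2 =>
      if isval M1 then
        if isval M2 then lapp (lapp (star M1 so sk) (star M2 so sk)) K
        else
          cps M2 so sk (llam (lapp (lapp (lsh (star M1 so sk)) (lvar 0)) (lsh K)))
      else
        if isval M2 then
          cps M1 so sk (llam (lapp (lapp (lvar 0) (lsh (star M2 so sk))) (lsh K)))
        else
          cps M1 so sk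
            (llam (cps M2 (shf so) (shf sk)
                     (llam (lapp (lapp (lvar 1) (lvar 0)) (lren (fun m => S (S m)) K)))))
  | Wh L N =>
      cps N so sk (llam (cps L (scons (lvar 0) (shf so)) (shf sk) (lsh K)))
  | Mu J =>
      lapp (llam (cpsj J (shf so) (scons (lvar 0) (shf sk)))) K
  end
with star (V : tm) (so sk : nat -> lt) {struct V} : lt :=
  match V with
  | Var n => so n
  | Lam B => llam (llam (cps B (scons (lvar 1) (shf2 so)) (shf2 sk) (lvar 0)))
  | _ => lvar 0 (* never used: only applied to values *)
  end
with cpsj (J : jmp) (so sk : nat -> lt) {struct J} : lt :=
  match J with
  | Jmp k Q => cps Q so sk (sk k)
  | JWh J' N => cps N so sk (llam (cpsj J' (scons (lvar 0) (shf so)) (shf sk)))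
  end.

(* [[M]] = \k. <M>[k].  Free ordinary variable n of M is sent to target
   variable 2n and free continuation variable n to 2n+1 (disjoint). *)
Definition cps_top (M : tm) : lt :=
  llam (cps M (fun n => lvar (S (2 * n))) (fun n => lvar (S (S (2 * n)))) (lvar 0)).

(* Main.v *)
(* From left to right: the congruence and every reduction rule preserve the
   CPS translation up to beta-eta conversion, and the translation of a normal
   term beta-reduces to a beta-normal form, so confluence of beta-eta applies.

   From right to left: the inverse of the CPS translation is replaced by a
   relation [simT] between source and target terms that contains the graph of
   the translation up to reduction of the source term, and along which every
   target step is matched by source reductions.  The administrative redexes
   mu k.[k]M that a naive inverse would create are absorbed by the rule
   [simT_abs].  A source term related to a beta-normal target term need not be
   normal, but all its remaining redexes shrink it ([good_step]), so it is
   normalizable. *)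
Require Import Defs.
From Stdlib Require Import Relations Arith Lia Btauto FunctionalExtensionality Classical.

(** Only weak normalization is at stake, so a target reduction to normal form is followed one step
    at a time, and each step may be answered by any number of source steps up to the congruence,
    possibly none. The obstacle is that a contraction in <M>[K] need not belong to M: it may lie
    inside K, it may substitute K for a continuation variable, or it may apply K to a value of M,
    and then it is really a step of the where-term whose body K represents. Hence K is a parameter
    of the simulation, and the step lemma has one alternative for each possibility.

    Both directions stop at beta-normality and leave the rest to a size argument: a beta-normal
    target term has only eta steps left, and these shrink it, as the remaining steps shrink a [good]
    source term. Excluded middle decides whether a step remains.

    Environments map source variables to arbitrary target terms. Value substitution, the binding of
    a mu variable to a continuation and context substitution then all become changes of environment
    in the translation. *)

Lemma scons_ext {A : Type} (f g : nat -> A) :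
  f 0 = g 0 -> (forall n, f (S n) = g (S n)) -> f = g.
Proof. intros H0 HS. apply functional_extensionality. intros [|n]; auto. Qed.

Ltac env_ext := apply scons_ext; [reflexivity | intro; simpl].

(** * Renaming and substitution in the target calculus *)

Lemma upr_id : upr (fun n => n) = (fun n => n).
Proof. env_ext; reflexivity. Qed.

Lemma lren_id (t : lt) : lren (fun n => n) t = t.
Proof. induction t; simpl; rewrite ?upr_id; congruence. Qed.

Lemma upr_comp (f g : nat -> nat) :
  (fun n => upr f (upr g n)) = upr (fun n => f (g n)).
Proof. env_ext; reflexivity. Qed.

Lemma lren_lren (t : lt) : forall f g,
  lren f (lren g t) = lren (fun n => f (g n)) t.
Proof.
  induction t; intros f g; simpl; rewrite ?IHt, ?IHt1, ?IHt2, ?upr_comp; reflexivity.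
Qed.

Lemma lsub_lren (t : lt) : forall s f,
  lsub s (lren f t) = lsub (fun n => s (f n)) t.
Proof.
  induction t; intros s f; simpl; rewrite ?IHt, ?IHt1, ?IHt2; try reflexivity.
  do 2 f_equal. env_ext; reflexivity.
Qed.

Lemma lren_lsub (t : lt) : forall f s,
  lren f (lsub s t) = lsub (fun n => lren f (s n)) t.
Proof.
  induction t; intros f s; simpl; rewrite ?IHt, ?IHt1, ?IHt2; try reflexivity.
  do 2 f_equal. env_ext. unfold lsh. rewrite !lren_lren. reflexivity.
Qed.

Lemma lsub_lsub (t : lt) : forall s r,
  lsub s (lsub r t) = lsub (fun n => lsub s (r n)) t.
Proof.
  induction t; intros s r; simpl; rewrite ?IHt, ?IHt1, ?IHt2; try reflexivity.
  do 2 f_equal. env_ext. unfold lsh. rewrite lsub_lren, lren_lsub. reflexivity.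
Qed.

Lemma lups_lvar : lups lvar = lvar.
Proof. env_ext; reflexivity. Qed.

Lemma lsub_lvar (t : lt) : lsub lvar t = t.
Proof. induction t; simpl; rewrite ?lups_lvar; congruence. Qed.

Lemma lren_as_lsub (f : nat -> nat) (t : lt) : lren f t = lsub (fun n => lvar (f n)) t.
Proof.
  rewrite <- (lsub_lvar (lren f t)), lsub_lren. reflexivity.
Qed.

Lemma lsub_scons_lsh (u t : lt) : lsub (scons u lvar) (lsh t) = t.
Proof. unfold lsh. rewrite lsub_lren. apply lsub_lvar. Qed.

Lemma lsub_lups_lsh (s : nat -> lt) (t : lt) : lsub (lups s) (lsh t) = lsh (lsub s t).
Proof. unfold lsh. rewrite lsub_lren, lren_lsub. reflexivity. Qed.

Lemma lren_upr_lsh (f : nat -> nat) (t : lt) : lren (upr f) (lsh t) = lsh (lren f t).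
Proof. unfold lsh. rewrite !lren_lren. reflexivity. Qed.

Lemma lsub_beta (s : nat -> lt) (B N : lt) :
  lsub s (lsub (scons N lvar) B) = lsub (scons (lsub s N) lvar) (lsub (lups s) B).
Proof.
  rewrite !lsub_lsub. f_equal. env_ext. symmetry. apply lsub_scons_lsh.
Qed.

Lemma lren_beta (f : nat -> nat) (B N : lt) :
  lren f (lsub (scons N lvar) B) = lsub (scons (lren f N) lvar) (lren (upr f) B).
Proof.
  rewrite lren_lsub, lsub_lren. f_equal. env_ext. reflexivity.
Qed.

Lemma lsub_upr_S_lvar0 (B : lt) : lsub (scons (lvar 0) lvar) (lren (upr S) B) = B.
Proof.
  rewrite lsub_lren. rewrite <- (lsub_lvar B) at 2. f_equal. env_ext. reflexivity.
Qed.

(** The existence half of the universal property of a pullback square of index maps. It passes under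
    binders and lifts from indices to terms, so that an equation between two renamed terms can be
    solved for a common preimage. *)
Definition pullback (f g f' g' : nat -> nat) : Prop :=
  forall x y, f x = g y -> exists z, x = f' z /\ y = g' z.

Lemma pullback_upr (f g f' g' : nat -> nat) :
  pullback f g f' g' -> pullback (upr f) (upr g) (upr f') (upr g').
Proof.
  intros H [|x] [|y] E; simpl in E; try discriminate.
  - exists 0; auto.
  - injection E as E. destruct (H _ _ E) as (z & -> & ->). exists (S z); auto.
Qed.

Lemma lren_pullback (a : lt) : forall b f g f' g', pullback f g f' g' ->
  lren f a = lren g b -> exists c, a = lren f' c /\ b = lren g' c.
Proof.
  induction a; intros [m|b|b1 b2] f g f' g' H E; simpl in E; try discriminate;
    injection E; intros.
  - destruct (H _ _ H0) as (z & -> & ->). exists (lvar z); auto.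
  - destruct (IHa _ _ _ _ _ (pullback_upr _ _ _ _ H) H0) as (c & -> & ->).
    exists (llam c); auto.
  - destruct (IHa1 _ _ _ _ _ H H1) as (c & -> & ->).
    destruct (IHa2 _ _ _ _ _ H H0) as (d & -> & ->).
    exists (lapp c d); auto.
Qed.

Lemma pullback_S_upr (f : nat -> nat) : pullback S (upr f) f S.
Proof.
  intros x [|y] E; simpl in E; [discriminate | injection E as ->]. exists y; auto.
Qed.

(** The square of weakening and renaming: it pulls an eta redex back along a renaming, where the
    function part has to be recognised as weakened again. *)
Lemma lsh_upr_inv (f : nat -> nat) (a b : lt) :
  lsh a = lren (upr f) b -> exists c, a = lren f c /\ b = lsh c.
Proof. apply lren_pullback, pullback_S_upr. Qed.

Lemma lsh_inj (a b : lt) : lsh a = lsh b -> a = b.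
Proof.
  intro E. rewrite <- (lsub_scons_lsh (lvar 0) a), E. apply lsub_scons_lsh.
Qed.

Lemma lsh_lvar0 (a : lt) : lsh a <> lvar 0.
Proof. destruct a; discriminate. Qed.

Lemma upr_eq_0 (f : nat -> nat) (n : nat) : upr f n = 0 -> n = 0.
Proof. destruct n; [auto | discriminate]. Qed.

Lemma lsh_llam_inv (a b : lt) :
  lsh a = llam b -> exists c, a = llam c /\ b = lren (upr S) c.
Proof. destruct a; try discriminate. injection 1 as <-. eauto. Qed.

(** * Abstract commutation *)

Section Commutation.
  Context {A : Type}.
  Implicit Types R S : relation A.

  Definition star_of R := clos_refl_trans A R.

  Definition commute R S : Prop :=
    forall a b c, R a b -> S a c -> exists d, S b d /\ R c d.

  Lemma commute_sym R S : commute R S -> commute S R.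
  Proof. intros H a b c Hb Hc. destruct (H _ _ _ Hc Hb) as (d & ? & ?). eauto. Qed.

  (** The R step must stay single while an S step may be answered by several; this lets the R step
      be carried along an S sequence by induction. *)
  Lemma commute_star_r R S :
    (forall a b c, R a b -> S a c -> exists d, star_of S b d /\ R c d) ->
    commute R (star_of S).
  Proof.
    intros H a b c Hab Hac. revert b Hab.
    apply clos_rt_rt1n in Hac. induction Hac as [a|a a' c Ha _ IH]; intros b Hab.
    - exists b. split; [apply rt_refl | exact Hab].
    - destruct (H _ _ _ Hab Ha) as (d & Hbd & Had).
      destruct (IH _ Had) as (e & Hde & Hce).
      exists e. split; [eapply rt_trans; eassumption | exact Hce].
  Qed.

  Lemma commute_star R S : commute R (star_of S) -> commute (star_of R) (star_of S).
  Proof.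
    intro H. apply commute_sym, commute_star_r.
    intros a b c Hb Hc. destruct (H _ _ _ Hc Hb) as (d & ? & ?).
    exists d. split; [apply rt_step |]; assumption.
  Qed.

  Lemma star_of_mono R S a b :
    (forall x y, R x y -> star_of S x y) -> star_of R a b -> star_of S a b.
  Proof.
    intros H. induction 1; [auto | apply rt_refl | eapply rt_trans; eassumption].
  Qed.

  Lemma commute_union_l R1 R2 S :
    commute (star_of R1) (star_of S) -> commute (star_of R2) (star_of S) ->
    commute (star_of (union A R1 R2)) (star_of S).
  Proof.
    intros H1 H2 a b c Hab. revert c. apply clos_rt_rt1n in Hab.
    induction Hab as [a|a a' b Ha _ IH]; intros c Hac.
    - exists c. split; [exact Hac | apply rt_refl].
    - assert (exists d, star_of S a' d /\ star_of (union A R1 R2) c d)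
        as (d & Had & Hcd).
      { destruct Ha as [Ha|Ha].
        - destruct (H1 a a' c) as (d & ? & ?); [apply rt_step | |]; auto.
          exists d. split; auto. eapply star_of_mono; [|eassumption].
          intros; apply rt_step; left; auto.
        - destruct (H2 a a' c) as (d & ? & ?); [apply rt_step | |]; auto.
          exists d. split; auto. eapply star_of_mono; [|eassumption].
          intros; apply rt_step; right; auto. }
      destruct (IH _ Had) as (e & ? & ?).
      exists e. split; [assumption | eapply rt_trans; eassumption].
  Qed.

  Lemma hindley_rosen R S :
    commute (star_of R) (star_of R) -> commute (star_of S) (star_of S) ->
    commute (star_of R) (star_of S) ->
    commute (star_of (union A R S)) (star_of (union A R S)).
  Proof.
    intros HR HS HRS.
    apply commute_union_l; apply commute_sym, commute_union_l; auto using commute_sym.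
  Qed.
End Commutation.

(** * Confluence of beta-eta *)

(** Parallel beta reduction in the style of Tait and Martin-Loef. Eta is kept in the separate
    relation [eta]; the two are joined by the Hindley-Rosen lemma. *)
Inductive par : lt -> lt -> Prop :=
| par_var : forall n, par (lvar n) (lvar n)
| par_lam : forall A B, par A B -> par (llam A) (llam B)
| par_app : forall A A' B B', par A A' -> par B B' -> par (lapp A B) (lapp A' B')
| par_beta : forall A A' B B', par A A' -> par B B' ->
    par (lapp (llam A) B) (lsub (scons B' lvar) A').

Inductive eta : lt -> lt -> Prop :=
| eta_top : forall F, eta (llam (lapp (lsh F) (lvar 0))) F
| eta_lam : forall A B, eta A B -> eta (llam A) (llam B)
| eta_appl : forall A A' B, eta A A' -> eta (lapp A B) (lapp A' B)
| eta_appr : forall A B B', eta B B' -> eta (lapp A B) (lapp A B').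

Notation lsteps := (star_of lstep).

Lemma par_refl (t : lt) : par t t.
Proof. induction t; constructor; auto. Qed.

Lemma par_lren (f : nat -> nat) (a b : lt) : par a b -> par (lren f a) (lren f b).
Proof.
  intro H. revert f.
  induction H; intro f; simpl; try rewrite lren_beta; constructor; auto.
Qed.

Lemma par_lsub (a b : lt) : par a b -> forall s r,
  (forall n, par (s n) (r n)) -> par (lsub s a) (lsub r b).
Proof.
  assert (Hup : forall s r, (forall n, par (s n) (r n)) ->
            forall n, par (lups s n) (lups r n)).
  { intros s r H [|n]; simpl; [constructor | apply par_lren, H]. }
  induction 1; intros s r Hs; simpl; try rewrite lsub_beta;
    try (constructor; auto); auto.
Qed.

Lemma par_scons (a b u v : lt) : par a b -> par u v ->
  par (lsub (scons u lvar) a) (lsub (scons v lvar) b).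
Proof. intros. apply par_lsub; auto. intros [|n]; simpl; auto using par_refl. Qed.

Lemma par_diamond : commute par par.
Proof.
  intros a b c Hb. revert c.
  induction Hb as [n|A B H IH|A A' B B' HA IHA HB IHB|A A' B B' HA IHA HB IHB];
    intros c Hc.
  - inversion Hc; subst. exists (lvar n). auto using par_refl.
  - inversion Hc; subst. destruct (IH _ H1) as (d & ? & ?).
    exists (llam d). split; constructor; auto.
  - inversion Hc as [| |? A2 ? B2 HA2 HB2|A0 A2 ? B2 HA2 HB2]; subst.
    + destruct (IHA _ HA2) as (d & ? & ?). destruct (IHB _ HB2) as (e & ? & ?).
      exists (lapp d e). split; constructor; auto.
    + destruct (IHB _ HB2) as (e & ? & ?).
      (* The induction hypothesis speaks of the whole abstraction, so the step of the body is
         wrapped into [par_lam], and the abstractions are stripped off again by inversion. *)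
      destruct (IHA _ (par_lam _ _ HA2)) as (d & Hd1 & Hd2).
      inversion HA; subst. inversion Hd1; subst. inversion Hd2; subst.
      eexists. split; [apply par_beta | apply par_scons]; eassumption.
  - inversion Hc as [| |? A2 ? B2 HA2 HB2|A0 A2 ? B2 HA2 HB2]; subst.
    + destruct (IHB _ HB2) as (e & ? & ?). inversion HA2; subst.
      destruct (IHA _ H2) as (d & ? & ?).
      eexists. split; [apply par_scons | apply par_beta]; eassumption.
    + destruct (IHA _ HA2) as (d & ? & ?). destruct (IHB _ HB2) as (e & ? & ?).
      eexists. split; apply par_scons; eassumption.
Qed.

(** Renaming creates no redex. Used with [S]: whatever happens inside the weakened function of an
    eta redex comes from the function itself. *)
Lemma par_lren_inv (a' b : lt) : par a' b -> forall f a, a' = lren f a ->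
  exists c, b = lren f c /\ par a c.
Proof.
  induction 1 as [n|A B H IH|A A' B B' HA IHA HB IHB|A A' B B' HA IHA HB IHB];
    intros f a E.
  - destruct a; try discriminate. eexists. split; [exact E | apply par_refl].
  - destruct a as [|a|]; try discriminate. injection E as E.
    destruct (IH _ _ E) as (c & -> & ?).
    exists (llam c). split; [reflexivity | constructor; auto].
  - destruct a as [| |a1 a2]; try discriminate. injection E as E1 E2.
    destruct (IHA _ _ E1) as (c & -> & ?). destruct (IHB _ _ E2) as (d & -> & ?).
    exists (lapp c d). split; [reflexivity | constructor; auto].
  - destruct a as [| |[|a1|] a2]; try discriminate. injection E as E1 E2.
    destruct (IHA _ _ E1) as (c & -> & ?). destruct (IHB _ _ E2) as (d & -> & ?).
    eexists. split; [symmetry; apply lren_beta | constructor; auto].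
Qed.

(* Contracting the body of an eta redex never leaves the eta redex,
   except by a beta step that has the same effect as the eta step. *)
Lemma par_eta_redex (F b : lt) : par (lapp (lsh F) (lvar 0)) b ->
  (exists F', b = lapp (lsh F') (lvar 0) /\ par F F') \/
  (exists F0 F', F = llam F0 /\ b = F' /\ par F0 F').
Proof.
  intro H. inversion H as [| |? A2 ? B2 HA HB|A0 A2 ? B2 HA HB E]; subst.
  - inversion HB; subst. destruct (par_lren_inv _ _ HA _ _ eq_refl) as (c & -> & ?).
    left. eauto.
  - inversion HB; subst. symmetry in E. apply lsh_llam_inv in E as (F0 & -> & ->).
    destruct (par_lren_inv _ _ HA _ _ eq_refl) as (c & -> & ?).
    right. exists F0, c. rewrite lsub_upr_S_lvar0. auto.
Qed.

Lemma eta_lren (f : nat -> nat) (a b : lt) : eta a b -> eta (lren f a) (lren f b).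
Proof.
  intro H. revert f. induction H; intro f; simpl; try (constructor; auto).
  rewrite lren_upr_lsh. constructor.
Qed.

Lemma eta_lsub (a b : lt) : eta a b -> forall s, eta (lsub s a) (lsub s b).
Proof.
  induction 1; intro s; simpl; try (constructor; auto).
  rewrite lsub_lups_lsh. constructor.
Qed.

Lemma etas_lam (a b : lt) : star_of eta a b -> star_of eta (llam a) (llam b).
Proof.
  induction 1; [apply rt_step; constructor; auto | apply rt_refl | eapply rt_trans; eauto].
Qed.

Lemma etas_app (a a' b b' : lt) :
  star_of eta a a' -> star_of eta b b' -> star_of eta (lapp a b) (lapp a' b').
Proof.
  intros Ha Hb. apply rt_trans with (lapp a' b).
  - clear Hb. induction Ha;
      [apply rt_step; constructor; auto | apply rt_refl | eapply rt_trans; eauto].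
  - clear Ha. induction Hb;
      [apply rt_step; constructor; auto | apply rt_refl | eapply rt_trans; eauto].
Qed.

Lemma etas_lren (f : nat -> nat) (a b : lt) :
  star_of eta a b -> star_of eta (lren f a) (lren f b).
Proof.
  induction 1; [apply rt_step, eta_lren; auto | apply rt_refl | eapply rt_trans; eauto].
Qed.

Lemma etas_lsub_env (t : lt) : forall s r,
  (forall n, star_of eta (s n) (r n)) -> star_of eta (lsub s t) (lsub r t).
Proof.
  induction t; intros s r H; simpl; auto using etas_app.
  apply etas_lam, IHt. intros [|n]; [apply rt_refl | apply etas_lren, H].
Qed.

Lemma etas_scons (a b u v : lt) : star_of eta a b -> star_of eta u v ->
  star_of eta (lsub (scons u lvar) a) (lsub (scons v lvar) b).
Proof.
  intros Ha Hu. apply rt_trans with (lsub (scons u lvar) b).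
  - induction Ha; [apply rt_step, eta_lsub; auto | apply rt_refl | eapply rt_trans; eauto].
  - apply etas_lsub_env. intros [|n]; [exact Hu | apply rt_refl].
Qed.

(** Beta may duplicate or erase an eta redex, so one eta step is answered by several while the
    parallel step stays single, as [commute_star_r] requires. The two overlaps, an eta redex over an
    abstraction and a beta redex whose abstraction is an eta redex, are settled by
    [par_eta_redex]. *)
Lemma eta_par_commute : forall a b c, par a c -> eta a b ->
  exists d, star_of eta c d /\ par b d.
Proof.
  intros a b c Hc. revert b.
  induction Hc as [n|A B H IH|A A' B B' HA IHA HB IHB|A A' B B' HA IHA HB IHB];
    intros b Hb.
  - inversion Hb.
  - inversion Hb as [F E|A0 A1 HA1| |]; subst.
    + destruct (par_eta_redex _ _ H) as [(F' & -> & ?)|(F0 & F' & -> & -> & ?)].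
      * exists F'. split; [apply rt_step; constructor | assumption].
      * exists (llam F'). split; [apply rt_refl | constructor; assumption].
    + destruct (IH _ HA1) as (d & ? & ?).
      exists (llam d). split; [apply etas_lam; assumption | constructor; assumption].
  - inversion Hb as [| |? A1 ? H1|? ? B1 H1]; subst.
    + destruct (IHA _ H1) as (d & ? & ?).
      exists (lapp d B'). split; [apply etas_app; [assumption | apply rt_refl] |].
      constructor; assumption.
    + destruct (IHB _ H1) as (d & ? & ?).
      exists (lapp A' d). split; [apply etas_app; [apply rt_refl | assumption] |].
      constructor; assumption.
  - inversion Hb as [| |? A1 ? H1|? ? B1 H1]; subst.
    + inversion H1 as [F E|? A2 H2| |]; subst.
      * destruct (par_eta_redex _ _ HA) as [(F' & -> & ?)|(F0 & F' & -> & -> & ?)].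
        -- exists (lapp F' B'). simpl. rewrite lsub_scons_lsh.
           split; [apply rt_refl | constructor; assumption].
        -- eexists. split; [apply rt_refl | constructor; assumption].
      * destruct (IHA _ H2) as (d & ? & ?).
        eexists. split; [apply etas_scons; [eassumption | apply rt_refl] |].
        constructor; assumption.
    + destruct (IHB _ H1) as (d & ? & ?).
      eexists. split; [apply etas_scons; [apply rt_refl | eassumption] |].
      constructor; assumption.
Qed.

Lemma lstep_lren_inv (a' b : lt) : lstep a' b -> forall f a, a' = lren f a ->
  exists c, b = lren f c /\ lstep a c.
Proof.
  induction 1; intros f a E.
  - destruct a as [| |[|a1|] a2]; try discriminate. injection E as E1 E2. subst.
    eexists. split; [symmetry; apply lren_beta | constructor].
  - destruct a as [|[| |a1 [n| |]]|]; try discriminate. injection E as E1 E2.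
    symmetry in E2. apply upr_eq_0 in E2 as ->.
    apply lsh_upr_inv in E1 as (c & -> & ->). exists c. split; [reflexivity | constructor].
  - destruct a as [|a|]; try discriminate. injection E as E.
    destruct (IHlstep _ _ E) as (c & -> & ?).
    exists (llam c). split; [reflexivity | constructor; auto].
  - destruct a as [| |a1 a2]; try discriminate. injection E as E1 ->.
    destruct (IHlstep _ _ E1) as (c & -> & ?).
    exists (lapp c a2). split; [reflexivity | constructor; auto].
  - destruct a as [| |a1 a2]; try discriminate. injection E as -> E1.
    destruct (IHlstep _ _ E1) as (c & -> & ?).
    exists (lapp a1 c). split; [reflexivity | constructor; auto].
Qed.

Lemma eta_lren_inv (a' b : lt) : eta a' b -> forall f a, a' = lren f a ->
  exists c, b = lren f c /\ eta a c.
Proof.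
  induction 1; intros f a E.
  - destruct a as [|[| |a1 [n| |]]|]; try discriminate. injection E as E1 E2.
    symmetry in E2. apply upr_eq_0 in E2 as ->.
    apply lsh_upr_inv in E1 as (c & -> & ->). exists c. split; [reflexivity | constructor].
  - destruct a as [|a|]; try discriminate. injection E as E.
    destruct (IHeta _ _ E) as (c & -> & ?).
    exists (llam c). split; [reflexivity | constructor; auto].
  - destruct a as [| |a1 a2]; try discriminate. injection E as E1 ->.
    destruct (IHeta _ _ E1) as (c & -> & ?).
    exists (lapp c a2). split; [reflexivity | constructor; auto].
  - destruct a as [| |a1 a2]; try discriminate. injection E as -> E1.
    destruct (IHeta _ _ E1) as (c & -> & ?).
    exists (lapp a1 c). split; [reflexivity | constructor; auto].
Qed.

(** A peak of two eta steps closes with at most one step on each side, so the reflexive closure has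
    the diamond property, and it generates the same reduction. *)
Definition eta_refl (a b : lt) : Prop := a = b \/ eta a b.

Lemma eta_redex_step (F b : lt) : eta (lapp (lsh F) (lvar 0)) b ->
  exists F', b = lapp (lsh F') (lvar 0) /\ eta F F'.
Proof.
  intro H. inversion H as [| |? ? ? H1|? ? ? H1]; subst; [|inversion H1].
  destruct (eta_lren_inv _ _ H1 _ _ eq_refl) as (c & -> & ?). eauto.
Qed.

Lemma eta_subconfluent : forall a b c, eta a b -> eta a c ->
  exists d, eta_refl b d /\ eta_refl c d.
Proof.
  intros a b c Hb. unfold eta_refl. revert c.
  induction Hb as [F|A B H IH|A A' B H IH|A B B' H IH]; intros c Hc.
  - inversion Hc as [F' E|? ? H1| |]; subst.
    + apply lsh_inj in E as ->. eauto.
    + destruct (eta_redex_step _ _ H1) as (F' & -> & ?).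
      exists F'. split; right; [assumption | constructor].
  - inversion Hc as [F' E|? ? H1| |]; subst.
    + destruct (eta_redex_step _ _ H) as (F' & -> & ?).
      exists F'. split; right; [constructor | assumption].
    + destruct (IH _ H1) as (d & Hd1 & Hd2). exists (llam d). split;
        [destruct Hd1 as [->|] | destruct Hd2 as [->|]];
        solve [left; reflexivity | right; constructor; assumption].
  - inversion Hc as [| |? ? ? H1|? ? ? H1]; subst.
    + destruct (IH _ H1) as (d & Hd1 & Hd2). exists (lapp d B). split;
        [destruct Hd1 as [->|] | destruct Hd2 as [->|]];
        solve [left; reflexivity | right; constructor; assumption].
    + exists (lapp A' B'). split; right; constructor; assumption.
  - inversion Hc as [| |? ? ? H1|? ? ? H1]; subst.
    + exists (lapp A' B'). split; right; constructor; assumption.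
    + destruct (IH _ H1) as (d & Hd1 & Hd2). exists (lapp A d). split;
        [destruct Hd1 as [->|] | destruct Hd2 as [->|]];
        solve [left; reflexivity | right; constructor; assumption].
Qed.

Lemma eta_commute : commute (star_of eta) (star_of eta).
Proof.
  assert (H : commute (star_of eta_refl) (star_of eta_refl)).
  { apply commute_star, commute_star_r. intros a b c [->|Hb] [->|Hc].
    - exists c. split; [apply rt_refl | left; reflexivity].
    - exists c. split; [apply rt_step; right; assumption | left; reflexivity].
    - exists b. split; [apply rt_refl | right; assumption].
    - destruct (eta_subconfluent _ _ _ Hb Hc) as (d & ? & ?).
      exists d. split; [apply rt_step |]; assumption. }
  assert (H1 : forall a b, star_of eta a b -> star_of eta_refl a b).
  { intros a b. apply star_of_mono. intros. apply rt_step. right. assumption. }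
  assert (H2 : forall a b, star_of eta_refl a b -> star_of eta a b).
  { intros a b. apply star_of_mono.
    intros x y [->|?]; [apply rt_refl | apply rt_step; assumption]. }
  intros a b c Hb Hc.
  destruct (H a b c) as (d & ? & ?); eauto.
Qed.

Lemma lsteps_lam (a b : lt) : lsteps a b -> lsteps (llam a) (llam b).
Proof.
  induction 1; [apply rt_step; constructor; auto | apply rt_refl | eapply rt_trans; eauto].
Qed.

Lemma lsteps_app (a a' b b' : lt) :
  lsteps a a' -> lsteps b b' -> lsteps (lapp a b) (lapp a' b').
Proof.
  intros Ha Hb. apply rt_trans with (lapp a' b).
  - clear Hb. induction Ha;
      [apply rt_step; constructor; auto | apply rt_refl | eapply rt_trans; eauto].
  - clear Ha. induction Hb;
      [apply rt_step; constructor; auto | apply rt_refl | eapply rt_trans; eauto].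
Qed.

Lemma par_lsteps (a b : lt) : par a b -> lsteps a b.
Proof.
  induction 1; auto using lsteps_lam, lsteps_app; [apply rt_refl |].
  eapply rt_trans; [apply lsteps_app; [apply lsteps_lam |]; eassumption |].
  apply rt_step. constructor.
Qed.

Lemma eta_lstep (a b : lt) : eta a b -> lstep a b.
Proof. induction 1; constructor; assumption. Qed.

Lemma lstep_par_eta (a b : lt) : lstep a b -> par a b \/ eta a b.
Proof.
  induction 1 as [| |? ? ? [|]|? ? ? ? [|]|? ? ? ? [|]];
    try (right; constructor; assumption); left; constructor; auto using par_refl.
Qed.

Lemma lstep_confluent : commute lsteps lsteps.
Proof.
  assert (H : commute (star_of (union lt par eta)) (star_of (union lt par eta))).
  { apply hindley_rosen.
    - apply commute_star, commute_star_r. intros a b c Hb Hc.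
      destruct (par_diamond _ _ _ Hb Hc) as (d & ? & ?).
      exists d. split; [apply rt_step |]; assumption.
    - apply eta_commute.
    - apply commute_star, commute_star_r. intros a b c Hb Hc.
      exact (eta_par_commute _ _ _ Hb Hc). }
  assert (H1 : forall a b, lsteps a b -> star_of (union lt par eta) a b).
  { intros a b. apply star_of_mono. intros x y Hs. apply rt_step.
    apply lstep_par_eta, Hs. }
  assert (H2 : forall a b, star_of (union lt par eta) a b -> lsteps a b).
  { intros a b. apply star_of_mono.
    intros x y [?|?]; [apply par_lsteps | apply rt_step, eta_lstep]; assumption. }
  intros a b c Hb Hc. destruct (H a b c) as (d & ? & ?); eauto.
Qed.

(** * Conversion and normal forms *)

Notation conv := (clos_refl_sym_trans lt lstep).

Lemma conv_join (a b : lt) : conv a b -> exists c, lsteps a c /\ lsteps b c.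
Proof.
  induction 1 as [a b H|a|a b _ (c & ? & ?)|a b c _ (d & Ha & Hb) _ (e & Hb' & Hc)].
  - exists b. split; [apply rt_step, H | apply rt_refl].
  - exists a. split; apply rt_refl.
  - eauto.
  - destruct (lstep_confluent _ _ _ Hb Hb') as (f & ? & ?).
    exists f. split; eapply rt_trans; eassumption.
Qed.

Lemma lnormal_lsteps (a b : lt) : lnormal a -> lsteps a b -> a = b.
Proof.
  intros Ha H. apply clos_rt_rt1n in H. destruct H; [reflexivity |].
  exfalso. apply Ha. eauto.
Qed.

(** By confluence [a] and the normal form of [b] have a common reduct, which can only be that normal
    form. *)
Lemma has_nf_conv (a b : lt) : conv a b -> has_nf b -> has_nf a.
Proof.
  intros H (n & Hbn & Hn).
  destruct (conv_join a n) as (c & Hac & Hnc).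
  { eapply rst_trans; [exact H | apply clos_rt_clos_rst, Hbn]. }
  apply lnormal_lsteps in Hnc as <-; [|exact Hn]. exists n. auto.
Qed.

(** * Beta-normal forms under eta reduction *)

Definition is_llam (t : lt) : bool := match t with llam _ => true | _ => false end.

(** Normality for beta alone: eta redexes may remain. *)
Fixpoint bnf (t : lt) : bool :=
  match t with
  | lvar _ => true
  | llam B => bnf B
  | lapp A B => negb (is_llam A) && bnf A && bnf B
  end.

Fixpoint lsize (t : lt) : nat :=
  match t with
  | lvar _ => 1
  | llam B => S (lsize B)
  | lapp A B => S (lsize A + lsize B)
  end.

Lemma lsize_lren (t : lt) : forall f, lsize (lren f t) = lsize t.
Proof. induction t; intro f; simpl; auto. Qed.

Lemma is_llam_lren (f : nat -> nat) (t : lt) : is_llam (lren f t) = is_llam t.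
Proof. destruct t; reflexivity. Qed.

Lemma bnf_lren (t : lt) : forall f, bnf (lren f t) = bnf t.
Proof.
  induction t; intro f; simpl; rewrite ?is_llam_lren, ?IHt, ?IHt1, ?IHt2; reflexivity.
Qed.

Lemma bnf_app (A B : lt) :
  bnf (lapp A B) = true <-> is_llam A = false /\ bnf A = true /\ bnf B = true.
Proof.
  simpl. rewrite !Bool.andb_true_iff, Bool.negb_true_iff. tauto.
Qed.

Lemma lnormal_bnf (t : lt) : lnormal t -> bnf t = true.
Proof.
  unfold lnormal. induction t as [n|B IH|A IHA B IHB]; intro H.
  - reflexivity.
  - apply IH. intros (t' & Ht). apply H. eexists. apply l_lam, Ht.
  - apply bnf_app. repeat split.
    + destruct A; try reflexivity. exfalso. apply H. eexists. apply l_beta.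
    + apply IHA. intros (t' & Ht). apply H. eexists. apply l_appl, Ht.
    + apply IHB. intros (t' & Ht). apply H. eexists. apply l_appr, Ht.
Qed.

(** Every step from a beta-normal term is an eta step, which shrinks the term. The last clause
    guards function positions: an eta step there cannot produce an abstraction and with it a new
    beta redex. *)
Lemma bnf_lstep (a b : lt) : lstep a b -> bnf a = true ->
  lsize b < lsize a /\ bnf b = true /\ (is_llam a = false -> is_llam b = false).
Proof.
  induction 1; intro Hb.
  - discriminate.
  - simpl in Hb. rewrite !Bool.andb_true_iff in Hb. unfold lsh in *.
    rewrite bnf_lren in Hb. simpl. rewrite lsize_lren. intuition (try lia; try discriminate).
  - destruct (IHlstep Hb) as (? & ? & ?). simpl. intuition lia.
  - apply bnf_app in Hb as (H1 & H2 & H3). destruct (IHlstep H2) as (? & ? & ?).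
    rewrite bnf_app. simpl. intuition lia.
  - apply bnf_app in Hb as (H1 & H2 & H3). destruct (IHlstep H3) as (? & ? & ?).
    rewrite bnf_app. simpl. intuition lia.
Qed.

Lemma bnf_has_nf (t : lt) : bnf t = true -> has_nf t.
Proof.
  remember (lsize t) as n eqn:E. revert t E.
  induction n as [n IH] using lt_wf_ind. intros t -> Hb.
  destruct (classic (exists t', lstep t t')) as [(t' & Ht)|Hn].
  - destruct (bnf_lstep _ _ Ht Hb) as (Hlt & Hb' & _).
    destruct (IH _ Hlt _ eq_refl Hb') as (u & ? & ?).
    exists u. split; [eapply rt_trans; [apply rt_step|]; eassumption | assumption].
  - exists t. split; [apply rt_refl | exact Hn].
Qed.

(** * The CPS translation and substitution *)

Scheme tm_mut := Induction for tm Sort Prop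
with jmp_mut := Induction for jmp Sort Prop.
Combined Scheme tm_jmp_ind from tm_mut, jmp_mut.

Notation "f >>> s" := (fun n => f (s n)) (at level 50, left associativity, only parsing).

Lemma shf2_shf (s : nat -> lt) : shf2 s = shf (shf s).
Proof.
  apply functional_extensionality. intro n. unfold shf2, shf, lsh.
  rewrite lren_lren. reflexivity.
Qed.

Lemma lren2_lsh (t : lt) : lren (fun m => S (S m)) t = lsh (lsh t).
Proof. unfold lsh. rewrite lren_lren. reflexivity. Qed.

Lemma cps_value (V : tm) (so sk : nat -> lt) (K : lt) :
  isval V = true -> cps V so sk K = lapp K (star V so sk).
Proof. destruct V; try discriminate; reflexivity. Qed.

Lemma shf_lsub (s so : nat -> lt) : lsub (lups s) >>> shf so = shf (lsub s >>> so).
Proof.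
  apply functional_extensionality. intro n. apply lsub_lups_lsh.
Qed.

Lemma scons0_lsub (s so : nat -> lt) :
  lsub (lups s) >>> scons (lvar 0) (shf so) = scons (lvar 0) (shf (lsub s >>> so)).
Proof. env_ext. apply lsub_lups_lsh. Qed.

Lemma scons1_lsub (s so : nat -> lt) :
  lsub (lups (lups s)) >>> scons (lvar 1) (shf (shf so)) =
  scons (lvar 1) (shf (shf (lsub s >>> so))).
Proof.
  env_ext. unfold shf at 1 2. rewrite lsub_lups_lsh. unfold shf.
  rewrite lsub_lups_lsh. reflexivity.
Qed.

(** A target substitution acts on the environments and the continuation. The clause for [star] is
    limited to values because the dummy [lvar 0] returned on other terms would itself be moved by
    the substitution. *)
Lemma cps_lsub_mut :
  (forall M,
    (forall s so sk K, lsub s (cps M so sk K) =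
       cps M (lsub s >>> so) (lsub s >>> sk) (lsub s K)) /\
    (isval M = true -> forall s so sk, lsub s (star M so sk) =
       star M (lsub s >>> so) (lsub s >>> sk))) /\
  (forall J s so sk, lsub s (cpsj J so sk) =
     cpsj J (lsub s >>> so) (lsub s >>> sk)).
Proof.
  apply tm_jmp_ind.
  - intro n. split; reflexivity.
  - intros B [IH _].
    assert (H : forall s so sk, lsub s (star (Lam B) so sk) =
       star (Lam B) (lsub s >>> so) (lsub s >>> sk)).
    { intros. simpl. rewrite IH, !shf2_shf, scons1_lsub, !shf_lsub. reflexivity. }
    split; [|auto]. intros. rewrite !cps_value by reflexivity.
    simpl lsub at 1. f_equal. apply H.
  - intros A [IHA SA] B [IHB SB]. split; [|discriminate]. intros. simpl.
    destruct (isval A) eqn:EA, (isval B) eqn:EB; simpl;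
      repeat (first [rewrite SA by auto | rewrite SB by auto | rewrite IHA
        | rewrite IHB | rewrite !lren2_lsh | rewrite lsub_lups_lsh | rewrite shf_lsub
        | progress simpl]); reflexivity.
  - intros L [IHL _] N [IHN _]. split; [|discriminate]. intros. simpl.
    rewrite IHN. simpl. rewrite IHL, scons0_lsub, shf_lsub, lsub_lups_lsh. reflexivity.
  - intros J IH. split; [|discriminate]. intros. simpl.
    rewrite IH, scons0_lsub, shf_lsub. reflexivity.
  - intros k M [IH _] s so sk. apply IH.
  - intros J IHJ N [IHN _] s so sk. simpl.
    rewrite IHN. simpl. rewrite IHJ, scons0_lsub, shf_lsub. reflexivity.
Qed.

Lemma cps_lsub (M : tm) (s so sk : nat -> lt) (K : lt) :
  lsub s (cps M so sk K) = cps M (lsub s >>> so) (lsub s >>> sk) (lsub s K).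
Proof. apply cps_lsub_mut. Qed.

Lemma cpsj_lsub (J : jmp) (s so sk : nat -> lt) :
  lsub s (cpsj J so sk) = cpsj J (lsub s >>> so) (lsub s >>> sk).
Proof. apply cps_lsub_mut. Qed.

Lemma star_lsub (V : tm) (s so sk : nat -> lt) : isval V = true ->
  lsub s (star V so sk) = star V (lsub s >>> so) (lsub s >>> sk).
Proof. intro. apply cps_lsub_mut; assumption. Qed.

Lemma star_lren (V : tm) (f : nat -> nat) (so sk : nat -> lt) : isval V = true ->
  lren f (star V so sk) = star V (lren f >>> so) (lren f >>> sk).
Proof.
  intro. rewrite lren_as_lsub, star_lsub by assumption.
  f_equal; apply functional_extensionality; intro; symmetry; apply lren_as_lsub.
Qed.

Lemma isval_oren (f : nat -> nat) (M : tm) : isval (oren f M) = isval M.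
Proof. destruct M; reflexivity. Qed.

Lemma isval_cren (f : nat -> nat) (M : tm) : isval (cren f M) = isval M.
Proof. destruct M; reflexivity. Qed.

Lemma scons_upr (a : lt) (so : nat -> lt) (f : nat -> nat) :
  scons a so >>> upr f = scons a (so >>> f).
Proof. env_ext. reflexivity. Qed.

Lemma cps_oren_mut :
  (forall M f,
    (forall so sk K, cps (oren f M) so sk K = cps M (so >>> f) sk K) /\
    (forall so sk, star (oren f M) so sk = star M (so >>> f) sk)) /\
  (forall J f so sk, cpsj (orenj f J) so sk = cpsj J (so >>> f) sk).
Proof.
  apply tm_jmp_ind; simpl; intros; rewrite ?isval_oren; try split; intros;
    repeat match goal with
    | H : forall f, (forall so sk K, cps (oren f ?M) so sk K = _) /\ _ |- _ =>
        let H1 := fresh in let H2 := fresh in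
        assert (H1 := fun f => proj1 (H f)); assert (H2 := fun f => proj2 (H f)); clear H
    end; simpl in *;
    repeat (match goal with H : forall f so sk K, _ |- _ => rewrite H
           | H : forall f so sk, _ |- _ => rewrite H end; rewrite ?scons_upr, ?shf2_shf);
    try reflexivity.
Qed.

Lemma cps_oren (f : nat -> nat) (M : tm) (so sk : nat -> lt) (K : lt) :
  cps (oren f M) so sk K = cps M (so >>> f) sk K.
Proof. apply cps_oren_mut. Qed.

Lemma star_oren (f : nat -> nat) (M : tm) (so sk : nat -> lt) :
  star (oren f M) so sk = star M (so >>> f) sk.
Proof. apply cps_oren_mut. Qed.

Lemma cpsj_orenj (f : nat -> nat) (J : jmp) (so sk : nat -> lt) :
  cpsj (orenj f J) so sk = cpsj J (so >>> f) sk.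
Proof. apply cps_oren_mut. Qed.

Lemma cps_cren_mut :
  (forall M f,
    (forall so sk K, cps (cren f M) so sk K = cps M so (sk >>> f) K) /\
    (forall so sk, star (cren f M) so sk = star M so (sk >>> f))) /\
  (forall J f so sk, cpsj (crenj f J) so sk = cpsj J so (sk >>> f)).
Proof.
  apply tm_jmp_ind; simpl; intros; rewrite ?isval_cren; try split; intros;
    repeat match goal with
    | H : forall f, (forall so sk K, cps (cren f ?M) so sk K = _) /\ _ |- _ =>
        let H1 := fresh in let H2 := fresh in
        assert (H1 := fun f => proj1 (H f)); assert (H2 := fun f => proj2 (H f)); clear H
    end; simpl in *;
    repeat (match goal with H : forall f so sk K, _ |- _ => rewrite H
           | H : forall f so sk, _ |- _ => rewrite H end; rewrite ?scons_upr, ?shf2_shf);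
    try reflexivity.
Qed.

Lemma cps_cren (f : nat -> nat) (M : tm) (so sk : nat -> lt) (K : lt) :
  cps (cren f M) so sk K = cps M so (sk >>> f) K.
Proof. apply cps_cren_mut. Qed.

Lemma star_cren (f : nat -> nat) (M : tm) (so sk : nat -> lt) :
  star (cren f M) so sk = star M so (sk >>> f).
Proof. apply cps_cren_mut. Qed.

Lemma cpsj_crenj (f : nat -> nat) (J : jmp) (so sk : nat -> lt) :
  cpsj (crenj f J) so sk = cpsj J so (sk >>> f).
Proof. apply cps_cren_mut. Qed.

Definition val_env (s : nat -> tm) : Prop := forall n, isval (s n) = true.

Lemma val_env_ups (s : nat -> tm) : val_env s -> val_env (ups s).
Proof.
  intros H [|n]; [reflexivity|]. simpl. unfold olift. rewrite isval_oren. apply H.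
Qed.

Lemma val_env_clift (s : nat -> tm) : val_env s -> val_env (fun n => clift (s n)).
Proof. intros H n. unfold clift. rewrite isval_cren. apply H. Qed.

Lemma isval_osub (s : nat -> tm) (M : tm) : val_env s -> isval (osub s M) = isval M.
Proof. intro H. destruct M; try reflexivity. apply H. Qed.

Definition star_env (s : nat -> tm) (so sk : nat -> lt) : nat -> lt :=
  fun n => star (s n) so sk.

Lemma star_env_shf (s : nat -> tm) (so sk : nat -> lt) : val_env s ->
  star_env s (shf so) (shf sk) = shf (star_env s so sk).
Proof.
  intro H. apply functional_extensionality. intro n. unfold shf, star_env, lsh.
  rewrite star_lren by apply H. reflexivity.
Qed.

Lemma star_env_ups (a : lt) (s : nat -> tm) (so sk : nat -> lt) :
  star_env (ups s) (scons a so) sk = scons a (star_env s so sk).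
Proof. env_ext. unfold star_env. simpl. unfold olift. rewrite star_oren. reflexivity. Qed.

Lemma star_env_clift (a : lt) (s : nat -> tm) (so sk : nat -> lt) :
  star_env (fun n => clift (s n)) so (scons a sk) = star_env s so sk.
Proof.
  apply functional_extensionality. intro n. unfold star_env, clift.
  rewrite star_cren. reflexivity.
Qed.

(** Values are substituted because [cps] branches on [isval]: replacing a variable by a non-value
    would select another clause for an enclosing application. *)
Lemma cps_osub_mut :
  (forall M s, val_env s ->
    (forall so sk K, cps (osub s M) so sk K = cps M (star_env s so sk) sk K) /\
    (isval M = true -> forall so sk, star (osub s M) so sk = star M (star_env s so sk) sk)) /\
  (forall J s, val_env s ->
    forall so sk, cpsj (osubj s J) so sk = cpsj J (star_env s so sk) sk).
Proof.
  apply tm_jmp_ind.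
  - intros n s Hs. split; [|reflexivity]. intros. simpl.
    rewrite cps_value by apply Hs. reflexivity.
  - intros B IH s Hs. destruct (IH _ (val_env_ups _ Hs)) as [IH' _]. clear IH.
    assert (H : forall so sk, star (osub s (Lam B)) so sk =
       star (Lam B) (star_env s so sk) sk).
    { intros. simpl. rewrite IH', star_env_ups, !shf2_shf, !star_env_shf by assumption.
      reflexivity. }
    split; [|auto]. intros. rewrite !cps_value by reflexivity. f_equal. apply H.
  - intros A IHA B IHB s Hs. destruct (IHA _ Hs) as [IHA' SA].
    destruct (IHB _ Hs) as [IHB' SB]. split; [|discriminate]. intros. simpl.
    rewrite !isval_osub by assumption.
    destruct (isval A) eqn:EA, (isval B) eqn:EB; simpl;
      rewrite ?SA, ?SB, ?IHA', ?IHB', ?star_env_shf by auto; reflexivity.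
  - intros L IHL N IHN s Hs. destruct (IHN _ Hs) as [IHN' _].
    destruct (IHL _ (val_env_ups _ Hs)) as [IHL' _]. split; [|discriminate].
    intros. simpl. rewrite IHN', IHL', star_env_ups, star_env_shf by assumption. reflexivity.
  - intros J IH s Hs. split; [|discriminate]. intros. simpl.
    rewrite (IH _ (val_env_clift _ Hs)), star_env_clift, star_env_shf by assumption.
    reflexivity.
  - intros k M IH s Hs so sk. apply IH, Hs.
  - intros J IHJ N IHN s Hs so sk. destruct (IHN _ Hs) as [IHN' _]. simpl.
    rewrite IHN', (IHJ _ (val_env_ups _ Hs)), star_env_ups, star_env_shf by assumption.
    reflexivity.
Qed.

Lemma cps_osub1 (M V : tm) (so sk : nat -> lt) (K : lt) : isval V = true ->
  cps (osub (scons V Var) M) so sk K = cps M (scons (star V so sk) so) sk K.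
Proof.
  intro HV. destruct cps_osub_mut as [H _].
  destruct (H M (scons V Var)) as [H' _]; [intros [|n]; auto|].
  rewrite H'. f_equal. env_ext. reflexivity.
Qed.

Lemma isval_ctxt (c : nat) (L M : tm) : isval (ctxt c L M) = isval M.
Proof. destruct M; reflexivity. Qed.

Definition upd (c : nat) (K : lt) (sk : nat -> lt) : nat -> lt :=
  fun k => if Nat.eqb k c then K else sk k.

Lemma upd_shf (c : nat) (K : lt) (sk : nat -> lt) :
  upd c (lsh K) (shf sk) = shf (upd c K sk).
Proof.
  apply functional_extensionality. intro k. unfold upd, shf. destruct (Nat.eqb k c); auto.
Qed.

Lemma upd_scons (c : nat) (a K : lt) (sk : nat -> lt) :
  upd (S c) K (scons a sk) = scons a (upd c K sk).
Proof. env_ext. reflexivity. Qed.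

(** The continuation \x.<L>[K] under which the argument of a where-term with body L is
    translated. *)
Definition where_cont (L : tm) (so sk : nat -> lt) (K : lt) : lt :=
  llam (cps L (scons (lvar 0) (shf so)) (shf sk) (lsh K)).

Lemma where_cont_lsh (L : tm) (so sk : nat -> lt) (K : lt) :
  lsh (where_cont L so sk K) = where_cont L (shf so) (shf sk) (lsh K).
Proof.
  unfold where_cont, lsh. rewrite lren_as_lsub. simpl. rewrite cps_lsub.
  do 2 f_equal.
  - env_ext. unfold shf, lsh. rewrite lsub_lren, !lren_lren, lren_as_lsub. reflexivity.
  - apply functional_extensionality. intro n.
    unfold shf, lsh. rewrite lsub_lren, !lren_lren, lren_as_lsub. reflexivity.
  - rewrite lsub_lren, !lren_lren, lren_as_lsub. reflexivity.
Qed.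

Lemma where_cont_shf (L : tm) (so sk : nat -> lt) (c : nat) :
  where_cont L (shf so) (shf sk) (shf sk c) = lsh (where_cont L so sk (sk c)).
Proof. symmetry. apply where_cont_lsh. Qed.

Lemma where_cont_oren (L : tm) (a : lt) (so sk : nat -> lt) (K : lt) :
  where_cont (oren (upr S) L) (scons a so) sk K = where_cont L so sk K.
Proof.
  unfold where_cont. rewrite cps_oren. do 2 f_equal. env_ext. reflexivity.
Qed.

Lemma where_cont_clift (L : tm) (a : lt) (so sk : nat -> lt) (K : lt) :
  where_cont (clift L) so (scons a sk) K = where_cont L so sk K.
Proof. unfold where_cont, clift. rewrite cps_cren. reflexivity. Qed.

(** On the target side, context substitution is an update of the environment: k is sent to
    \x.<L>[k]. The old image [sk c] survives inside the new one, since the replaced jumps still go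
    to k. *)
Lemma cps_ctxt_mut :
  (forall M c L,
    (forall so sk K, cps (ctxt c L M) so sk K =
       cps M so (upd c (where_cont L so sk (sk c)) sk) K) /\
    (isval M = true -> forall so sk, star (ctxt c L M) so sk =
       star M so (upd c (where_cont L so sk (sk c)) sk))) /\
  (forall J c L so sk, cpsj (ctxj c L J) so sk =
     cpsj J so (upd c (where_cont L so sk (sk c)) sk)).
Proof.
  apply tm_jmp_ind.
  - split; reflexivity.
  - intros B IH c L.
    assert (H : forall so sk, star (ctxt c L (Lam B)) so sk =
       star (Lam B) so (upd c (where_cont L so sk (sk c)) sk)).
    { intros. simpl. rewrite (proj1 (IH c _)), where_cont_oren, !shf2_shf.
      rewrite !where_cont_shf, !upd_shf. reflexivity. }
    split; [|auto]. intros. rewrite !cps_value by reflexivity. f_equal. apply H.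
  - intros A IHA B IHB c L. destruct (IHA c L) as [IHA' SA].
    destruct (IHB c L) as [IHB' SB]. split; [|discriminate]. intros. simpl.
    rewrite !isval_ctxt. destruct (isval A) eqn:EA, (isval B) eqn:EB; simpl;
      rewrite ?SA, ?SB, ?IHA', ?IHB' by auto; try reflexivity.
    rewrite where_cont_shf, upd_shf. reflexivity.
  - intros M IHM N IHN c L. split; [|discriminate]. intros. simpl.
    rewrite (proj1 (IHN c L)), (proj1 (IHM c _)), where_cont_oren.
    rewrite where_cont_shf, upd_shf. reflexivity.
  - intros J IH c L. split; [|discriminate]. intros. simpl.
    rewrite IH, upd_scons, where_cont_clift. simpl.
    rewrite where_cont_shf, upd_shf. reflexivity.
  - intros k M IH c L so sk. simpl. destruct (Nat.eqb k c) eqn:E; simpl;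
      rewrite (proj1 (IH c L)); f_equal; unfold upd; rewrite E; [|reflexivity].
    apply Nat.eqb_eq in E as ->. reflexivity.
  - intros J IHJ N IHN c L so sk. simpl.
    rewrite (proj1 (IHN c L)), IHJ, where_cont_oren.
    rewrite where_cont_shf, upd_shf. reflexivity.
Qed.

Lemma cpsj_ctxj0 (J : jmp) (L : tm) (so sk : nat -> lt) (K : lt) :
  cpsj (ctxj 0 (clift L) J) so (scons K sk) = cpsj J so (scons (where_cont L so sk K) sk).
Proof.
  destruct cps_ctxt_mut as [_ H]. rewrite H. f_equal.
  rewrite where_cont_clift. env_ext. reflexivity.
Qed.

(** * Soundness of the CPS translation *)

Lemma conv_step (a b : lt) : lstep a b -> conv a b.
Proof. apply rst_step. Qed.

Lemma conv_map (f : lt -> lt) :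
  (forall a b, lstep a b -> lstep (f a) (f b)) ->
  forall a b, conv a b -> conv (f a) (f b).
Proof.
  intros Hf a b. induction 1;
    [apply rst_step; auto | apply rst_refl | apply rst_sym; auto | eapply rst_trans; eauto].
Qed.

Lemma lsteps_map (f : lt -> lt) :
  (forall a b, lstep a b -> lstep (f a) (f b)) ->
  forall a b, lsteps a b -> lsteps (f a) (f b).
Proof.
  intros Hf a b. induction 1;
    [apply rt_step; auto | apply rt_refl | eapply rt_trans; eauto].
Qed.

Lemma conv_lam (a b : lt) : conv a b -> conv (llam a) (llam b).
Proof. apply (conv_map llam). constructor; assumption. Qed.

Lemma conv_appl (a a' b : lt) : conv a a' -> conv (lapp a b) (lapp a' b).
Proof. apply (conv_map (fun x => lapp x b)). constructor; assumption. Qed.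

Lemma conv_appr (a b b' : lt) : conv b b' -> conv (lapp a b) (lapp a b').
Proof. apply (conv_map (lapp a)). constructor; assumption. Qed.

Lemma lstep_lren (f : nat -> nat) (a b : lt) : lstep a b -> lstep (lren f a) (lren f b).
Proof.
  intro H. revert f. induction H; intro f; simpl; try (constructor; auto).
  - rewrite lren_beta. constructor.
  - rewrite lren_upr_lsh. constructor.
Qed.

(** The continuation occurs exactly once in <M>[K], so one step of K is one step of the
    translation. *)
Lemma lstep_cps_cont (M : tm) : forall so sk K K',
  lstep K K' -> lstep (cps M so sk K) (cps M so sk K').
Proof.
  induction M as [n|B _|A IHA B IHB|L IHL N IHN|J]; intros so sk K K' H; simpl;
    try (constructor; assumption).
  - destruct (isval A), (isval B);
      repeat first [apply IHA | apply IHB | apply lstep_lren | apply H | constructor 3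
        | constructor 5].
  - apply IHN, l_lam, IHL, lstep_lren, H.
Qed.

Lemma conv_cps_cont (M : tm) (so sk : nat -> lt) (K K' : lt) :
  conv K K' -> conv (cps M so sk K) (cps M so sk K').
Proof. apply conv_map. intros. apply lstep_cps_cont. assumption. Qed.

Lemma cps_mu_step (J : jmp) (so sk : nat -> lt) (K : lt) :
  lstep (cps (Mu J) so sk K) (cpsj J so (scons K sk)).
Proof.
  simpl. assert (E : cpsj J so (scons K sk) =
    lsub (scons K lvar) (cpsj J (shf so) (scons (lvar 0) (shf sk)))).
  { rewrite cpsj_lsub. f_equal.
    - apply functional_extensionality. intro n. symmetry. apply lsub_scons_lsh.
    - env_ext. symmetry. apply lsub_scons_lsh. }
  rewrite E. constructor.
Qed.

Lemma star_shf (V : tm) (so sk : nat -> lt) : isval V = true ->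
  star V (shf so) (shf sk) = lsh (star V so sk).
Proof. intro H. symmetry. apply star_lren, H. Qed.

(** The four clauses for application agree up to beta with the clause for two non-values. Soundness
    under an application then needs no analysis of steps that turn a non-value into a value. *)
Lemma cps_app_conv (A B : tm) (so sk : nat -> lt) (K : lt) :
  conv (cps (App A B) so sk K)
       (cps A so sk (llam (cps B (shf so) (shf sk)
          (llam (lapp (lapp (lvar 1) (lvar 0)) (lsh (lsh K))))))).
Proof.
  simpl. destruct (isval A) eqn:EA, (isval B) eqn:EB; rewrite ?lren2_lsh.
  - rewrite (cps_value A), (cps_value B), star_shf by assumption. apply rst_sym.
    eapply rst_trans.
    + apply conv_step, l_appl, l_lam, l_beta.
    + eapply rst_trans; [apply conv_step, l_beta|]. simpl. rewrite !lsub_scons_lsh.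
      apply rst_refl.
  - rewrite (cps_value A) by assumption. apply rst_sym.
    eapply rst_trans; [apply conv_step, l_beta|]. rewrite cps_lsub. simpl.
    rewrite !lsub_lups_lsh, lsub_scons_lsh.
    assert (E : forall s, lsub (scons (star A so sk) lvar) >>> shf s = s).
    { intro s. apply functional_extensionality. intro n. apply lsub_scons_lsh. }
    rewrite !E. apply rst_refl.
  - apply conv_cps_cont. rewrite (cps_value B), star_shf by assumption. apply rst_sym.
    eapply rst_trans; [apply conv_step, l_lam, l_beta|]. simpl. rewrite lsub_scons_lsh.
    apply rst_refl.
  - apply rst_refl.
Qed.

Lemma conv_appl_cps (A A' B : tm) (so sk : nat -> lt) (K : lt) :
  (forall K, conv (cps A so sk K) (cps A' so sk K)) ->
  conv (cps (App A B) so sk K) (cps (App A' B) so sk K).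
Proof.
  intro H. eapply rst_trans; [apply cps_app_conv|].
  eapply rst_trans; [apply H|]. apply rst_sym, cps_app_conv.
Qed.

Lemma conv_appr_cps (A B B' : tm) (so sk : nat -> lt) (K : lt) :
  (forall so sk K, conv (cps B so sk K) (cps B' so sk K)) ->
  conv (cps (App A B) so sk K) (cps (App A B') so sk K).
Proof.
  intro H. eapply rst_trans; [apply cps_app_conv|].
  eapply rst_trans; [apply conv_cps_cont, conv_lam, H|]. apply rst_sym, cps_app_conv.
Qed.

Scheme ec_mut := Induction for ec Sort Prop
with ecj_mut := Induction for ecj Sort Prop.
Combined Scheme ec_ecj_ind from ec_mut, ecj_mut.

Scheme step_mut := Induction for step Sort Prop
with stepj_mut := Induction for stepj Sort Prop.
Combined Scheme step_stepj_ind from step_mut, stepj_mut.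

(** (E1) is an equality of translations. (E2) costs the contraction of the administrative mu redex
    on each side. *)
Lemma eax_sound (M N : tm) : eax M N ->
  forall so sk K, conv (cps M so sk K) (cps N so sk K).
Proof.
  intros [L P Q|J P] so sk K.
  - simpl. apply conv_cps_cont, conv_lam, conv_cps_cont.
    change (conv (lsh (where_cont L so sk K))
      (where_cont (oren (upr S) L) (scons (lvar 0) (shf so)) (shf sk) (lsh K))).
    rewrite where_cont_oren, where_cont_lsh. apply rst_refl.
  - change (cps (Wh (Mu J) P) so sk K) with (cps P so sk (where_cont (Mu J) so sk K)).
    eapply rst_trans;
      [|apply rst_sym, conv_step, cps_mu_step].
    simpl cpsj. unfold clift. rewrite cps_cren. apply conv_cps_cont, conv_lam.
    eapply rst_trans; [apply conv_step, cps_mu_step|].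
    assert (E : scons (lsh K) (shf sk) = shf (scons K sk)) by (env_ext; reflexivity).
    rewrite E. apply rst_refl.
Qed.

Lemma eaxj_sound (J J' : jmp) : eaxj J J' ->
  forall so sk, conv (cpsj J so sk) (cpsj J' so sk).
Proof.
  intros [J0 P Q|k L P] so sk; simpl; [|apply rst_refl].
  apply conv_cps_cont, conv_lam, conv_cps_cont. unfold lsh. simpl.
  rewrite lren_as_lsub, cpsj_lsub, cpsj_orenj.
  match goal with |- conv (llam (cpsj _ ?a ?b)) (llam (cpsj _ ?c ?d)) =>
    assert (E1 : a = c); [|assert (E2 : b = d); [|rewrite E1, E2; apply rst_refl]] end.
  - env_ext. unfold shf, lsh. simpl.
    rewrite lsub_lren, ?lren_lren, lren_as_lsub. simpl. rewrite ?lsub_lren. reflexivity.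
  - apply functional_extensionality. intro n.
    unfold shf, lsh. simpl.
    rewrite lsub_lren, ?lren_lren, lren_as_lsub. simpl. rewrite ?lsub_lren. reflexivity.
Qed.

Lemma ec_sound :
  (forall M N, ec M N -> forall so sk K, conv (cps M so sk K) (cps N so sk K)) /\
  (forall J J', ecj J J' -> forall so sk, conv (cpsj J so sk) (cpsj J' so sk)).
Proof.
  apply ec_ecj_ind; intros;
    first [apply conv_appl_cps; auto | apply conv_appr_cps; auto | simpl];
    auto using eax_sound, eaxj_sound, conv_cps_cont, conv_lam, conv_appl, conv_appr.
Qed.

Lemma teq_sound (M N : tm) : teq M N ->
  forall so sk K, conv (cps M so sk K) (cps N so sk K).
Proof.
  induction 1; intros.
  - apply ec_sound; assumption.
  - apply rst_refl.
  - apply rst_sym; auto.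
  - eapply rst_trans; eauto.
Qed.

Lemma where_cont_beta (M : tm) (so sk : nat -> lt) (K w : lt) :
  lsub (scons w lvar) (cps M (scons (lvar 0) (shf so)) (shf sk) (lsh K)) =
  cps M (scons w so) sk K.
Proof.
  rewrite cps_lsub, lsub_scons_lsh. f_equal.
  - env_ext. apply lsub_scons_lsh.
  - apply functional_extensionality. intro n. apply lsub_scons_lsh.
Qed.

(** The two rules that name an argument leave the translation unchanged. Target eta serves two
    rules: [R_eta], which takes two eta steps because a source abstraction becomes two target
    binders, and [R_whx], where the continuation \x.K x collapses to K. *)
Lemma rtop_sound (M N : tm) : rtop M N ->
  forall so sk K, conv (cps M so sk K) (cps N so sk K).
Proof.
  intros H so sk K. destruct H as [N M HN|V N HV HN|M V HV|M V HV|M J|V HV|M|M].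
  - simpl. rewrite HN. unfold olift. rewrite isval_oren. simpl.
    destruct (isval M) eqn:EM.
    + rewrite star_oren. unfold lsh. rewrite star_lren by assumption. apply rst_refl.
    + rewrite cps_oren, lren2_lsh. apply rst_refl.
  - simpl. rewrite HV, HN. unfold olift. rewrite isval_oren, HV. simpl.
    rewrite star_oren. unfold lsh. rewrite star_lren by assumption. apply rst_refl.
  - simpl. rewrite HV, (cps_value V) by assumption.
    eapply rst_trans; [apply conv_step, l_appl, l_beta|].
    eapply rst_trans; [apply conv_step, l_beta|].
    eapply rst_trans; [|apply rst_sym, conv_step, l_beta].
    rewrite lsub_lsub, where_cont_beta, cps_lsub. simpl. rewrite !shf2_shf.
    match goal with |- conv (cps _ ?a ?b _) (cps _ ?c ?d _) =>
      assert (E1 : a = c); [|assert (E2 : b = d); [|rewrite E1, E2; apply rst_refl]] end.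
    + apply scons_ext; [apply lsub_scons_lsh | intro n; simpl].
      rewrite <- lsub_lsub. unfold shf. rewrite lsub_lups_lsh, !lsub_scons_lsh.
      reflexivity.
    + apply functional_extensionality. intro n. rewrite <- lsub_lsub. unfold shf.
      rewrite lsub_lups_lsh, !lsub_scons_lsh. reflexivity.
  - simpl. rewrite (cps_value V), cps_osub1, <- (where_cont_beta _ so) by assumption.
    apply conv_step, l_beta.
  - change (cps (Wh M (Mu J)) so sk K) with (cps (Mu J) so sk (where_cont M so sk K)).
    eapply rst_trans; [apply conv_step, cps_mu_step|].
    rewrite <- cpsj_ctxj0. apply rst_sym, conv_step, cps_mu_step.
  - rewrite (cps_value V), (cps_value (Lam _)) by auto. apply conv_appr. simpl.
    unfold olift. rewrite isval_oren, HV, star_oren.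
    assert (E : star V (scons (lvar 1) (shf2 so) >>> S) (shf2 sk) =
      lsh (lsh (star V so sk))).
    { rewrite <- !star_shf by assumption. rewrite !shf2_shf. reflexivity. }
    rewrite E. eapply rst_trans; [|apply conv_step, l_eta].
    apply conv_lam, conv_step.
    change (lapp (lsh (lsh (star V so sk))) (lvar 1)) with
      (lsh (lapp (lsh (star V so sk)) (lvar 0))). constructor.
  - simpl. apply conv_cps_cont, conv_step, l_eta.
  - eapply rst_trans; [apply conv_step, cps_mu_step|]. simpl. unfold clift.
    rewrite cps_cren. apply rst_refl.
Qed.

Lemma step_sound :
  (forall M N, step M N -> forall so sk K, conv (cps M so sk K) (cps N so sk K)) /\
  (forall J J', stepj J J' -> forall so sk, conv (cpsj J so sk) (cpsj J' so sk)).
Proof.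
  apply step_stepj_ind; intros;
    first [apply conv_appl_cps; auto | apply conv_appr_cps; auto | simpl];
    auto using rtop_sound, conv_cps_cont, conv_lam, conv_appl, conv_appr.
  destruct r as [l J]. simpl. eapply rst_trans; [apply conv_step, cps_mu_step|].
  unfold csubst0. rewrite cpsj_crenj.
  assert (E : scons (sk l) sk = sk >>> scons l (fun m => m)) by (env_ext; reflexivity).
  rewrite E. apply rst_refl.
Qed.

Lemma reds_sound (M N : tm) : clos_refl_trans tm red M N ->
  forall so sk K, conv (cps M so sk K) (cps N so sk K).
Proof.
  induction 1 as [M N (M' & N' & HM & Hs & HN)|M|M N P _ IH1 _ IH2]; intros.
  - eapply rst_trans; [apply teq_sound; eassumption|].
    eapply rst_trans; [apply step_sound; eassumption|]. apply teq_sound; assumption.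
  - apply rst_refl.
  - eapply rst_trans; eauto.
Qed.

(** * Source terms whose CPS translation has no genuine beta redex *)

Notation teqj := (clos_refl_sym_trans jmp ecj).

Definition redj (J J' : jmp) : Prop :=
  exists J1 J2, teqj J J1 /\ stepj J1 J2 /\ teqj J2 J'.

Definition reducible (M : tm) : Prop := exists N, red M N.

(** Reading (E3) from right to left collects all where-clauses of a jump under its bracket: up to
    the congruence, every jump is [k]M with [jtail] as k and [jbody] as M. *)
Fixpoint jtail (J : jmp) : nat :=
  match J with Jmp k _ => k | JWh J' _ => jtail J' end.

Fixpoint jbody (J : jmp) : tm :=
  match J with Jmp _ M => M | JWh J' N => Wh (jbody J') N end.

Lemma rst_map {A B : Type} (R : relation A) (S : relation B) (f : A -> B) :
  (forall a b, R a b -> S (f a) (f b)) ->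
  forall a b, clos_refl_sym_trans A R a b -> clos_refl_sym_trans B S (f a) (f b).
Proof.
  intros Hf a b. induction 1;
    [apply rst_step; auto | apply rst_refl | apply rst_sym; auto | eapply rst_trans; eauto].
Qed.

Lemma teqj_jump (J : jmp) : teqj J (Jmp (jtail J) (jbody J)).
Proof.
  induction J as [k M|J IH N]; simpl; [apply rst_refl|].
  eapply rst_trans.
  - apply (rst_map ecj ecj (fun J => JWh J N)); [|exact IH]. intros. apply ecj_whl. assumption.
  - apply rst_sym, rst_step, ecj_ax, E3.
Qed.

Lemma teq_mu (J J' : jmp) : teqj J J' -> teq (Mu J) (Mu J').
Proof. apply (rst_map ecj ec Mu). apply ec_mu. Qed.

Lemma red_step (M N : tm) : step M N -> red M N.
Proof. intro H. exists M, N. repeat split; auto; apply rst_refl. Qed.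

Lemma red_top (M N : tm) : rtop M N -> red M N.
Proof. intro H. apply red_step, s_top, H. Qed.

Lemma red_teq_l (M M' N : tm) : teq M M' -> red M' N -> red M N.
Proof.
  intros H (M1 & N1 & ? & ? & ?). exists M1, N1. repeat split; auto.
  eapply rst_trans; eassumption.
Qed.

Lemma red_ctx (f : tm -> tm) :
  (forall M N, ec M N -> ec (f M) (f N)) -> (forall M N, step M N -> step (f M) (f N)) ->
  forall M N, red M N -> red (f M) (f N).
Proof.
  intros He Hs M N (M1 & N1 & ? & ? & ?). exists (f M1), (f N1).
  repeat split; auto; eapply rst_map; eassumption.
Qed.

Lemma red_lam (M N : tm) : red M N -> red (Lam M) (Lam N).
Proof. apply red_ctx; intros; [apply ec_lam | apply s_lam]; assumption. Qed.

Lemma red_appl (M M' N : tm) : red M M' -> red (App M N) (App M' N).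
Proof. apply (red_ctx (fun M => App M N)); intros; [apply ec_appl | apply s_appl]; assumption. Qed.

Lemma red_appr (M N N' : tm) : red N N' -> red (App M N) (App M N').
Proof. apply (red_ctx (App M)); intros; [apply ec_appr | apply s_appr]; assumption. Qed.

Lemma red_whl (L L' N : tm) : red L L' -> red (Wh L N) (Wh L' N).
Proof. apply (red_ctx (fun L => Wh L N)); intros; [apply ec_whl | apply s_whl]; assumption. Qed.

Lemma red_whr (L N N' : tm) : red N N' -> red (Wh L N) (Wh L N').
Proof. apply (red_ctx (Wh L)); intros; [apply ec_whr | apply s_whr]; assumption. Qed.

Lemma red_mu (J J' : jmp) : redj J J' -> red (Mu J) (Mu J').
Proof.
  intros (J1 & J2 & ? & ? & ?). exists (Mu J1), (Mu J2).
  repeat split; auto using teq_mu. apply s_mu. assumption.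
Qed.

Lemma redj_jmp (k : nat) (M N : tm) : red M N -> redj (Jmp k M) (Jmp k N).
Proof.
  intros (M1 & N1 & ? & ? & ?). exists (Jmp k M1), (Jmp k N1).
  repeat split; [|apply sj_jmp; assumption|];
    (apply (rst_map ec ecj (Jmp k)); [apply ecj_jmp | assumption]).
Qed.

Definition is_var (M : tm) : bool := match M with Var _ => true | _ => false end.

(* Modulo (E1), [L where x := N] can only be irreducible when each
   component of the where-chain [N] is an application. *)
Fixpoint garg (N : tm) : bool :=
  match N with
  | App _ _ => true
  | Wh N1 N2 => garg N1 && garg N2
  | _ => false
  end.

(** An over-approximation of the normal forms, invariant under the congruence. It leaves room for
    four rules only, [R_eta], [R_whx], [R_mu] and [R_jmu], whose redexes are invisible to
    beta-normality of the translation. *)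
Fixpoint good (M : tm) : bool :=
  match M with
  | Var _ => true
  | Lam B => good B
  | App A B => is_var A && isval B && good B
  | Wh L N => good L && good N && garg N
  | Mu J => goodj J
  end
with goodj (J : jmp) : bool :=
  match J with
  | Jmp _ M => good M
  | JWh J' N => goodj J' && good N && garg N
  end.

(** The body L is quantified inside the induction because (E1) moves the inner where outwards: the
    bad component of the chain then meets either the weakened L or a where-term built on it. *)
Lemma reducible_where (N : tm) : garg N = false -> forall L, reducible (Wh L N).
Proof.
  induction N as [n|B _|A _ B _|N1 IH1 N2 IH2|J]; intros HN L; simpl in HN.
  - eexists. apply red_top, R_whV. reflexivity.
  - eexists. apply red_top, R_whV. reflexivity.
  - discriminate.
  - assert (He : teq (Wh L (Wh N1 N2)) (Wh (Wh (oren (upr S) L) N1) N2)).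
    { apply rst_step, ec_ax, E1. }
    apply Bool.andb_false_iff in HN as [HN|HN].
    + destruct (IH1 HN (oren (upr S) L)) as (P & HP).
      eexists. eapply red_teq_l; [exact He|]. apply red_whl, HP.
    + destruct (IH2 HN (Wh (oren (upr S) L) N1)) as (P & HP).
      eexists. eapply red_teq_l; [exact He|]. exact HP.
  - eexists. apply red_top, R_whMu.
Qed.

(** A jump is handled through [jbody], so that its where-clauses are treated like those of a term.
    The enclosing mu recovers the jump by [teqj_jump]. *)
Lemma not_good_reducible :
  (forall M, good M = false -> reducible M) /\
  (forall J, goodj J = false -> reducible (jbody J)).
Proof.
  apply tm_jmp_ind; simpl.
  - discriminate.
  - intros B IH H. destruct (IH H) as (N & ?). eexists. apply red_lam. eassumption.
  - intros A IHA B IHB H. destruct (isval A) eqn:EA.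
    + destruct (isval B) eqn:EB.
      * destruct A; try discriminate; simpl in H.
        -- destruct (IHB H) as (N & ?). eexists. apply red_appr. eassumption.
        -- eexists. apply red_top, R_beta, EB.
      * eexists. apply red_top, R_appV; assumption.
    + eexists. apply red_top, R_appN, EA.
  - intros L IHL N IHN H. rewrite !Bool.andb_false_iff in H.
    destruct H as [[H|H]|H].
    + destruct (IHL H) as (P & ?). eexists. apply red_whl. eassumption.
    + destruct (IHN H) as (P & ?). eexists. apply red_whr. eassumption.
    + apply reducible_where, H.
  - intros J IH H. destruct (IH H) as (N & ?).
    exists (Mu (Jmp (jtail J) N)). eapply red_teq_l; [apply teq_mu, teqj_jump|].
    apply red_mu, redj_jmp. eassumption.
  - intros k M IH H. auto.
  - intros J IHJ N IHN H. rewrite !Bool.andb_false_iff in H.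
    destruct H as [[H|H]|H].
    + destruct (IHJ H) as (P & ?). eexists. apply red_whl. eassumption.
    + destruct (IHN H) as (P & ?). eexists. apply red_whr. eassumption.
    + apply reducible_where, H.
Qed.

Lemma src_normal_good (M : tm) : src_normal M -> good M = true.
Proof.
  intro H. destruct (good M) eqn:E; [reflexivity|].
  exfalso. apply H, not_good_reducible, E.
Qed.

(** * Beta-normal forms of translated good terms *)

Definition var_env (s : nat -> lt) : Prop := forall n, exists i, s n = lvar i.

Lemma var_env_shf (s : nat -> lt) : var_env s -> var_env (shf s).
Proof. intros H n. unfold shf. destruct (H n) as [i ->]. eexists. reflexivity. Qed.

Lemma var_env_scons (i : nat) (s : nat -> lt) : var_env s -> var_env (scons (lvar i) s).
Proof. intros H [|n]; simpl; eauto. Qed.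

Local Hint Resolve var_env_shf var_env_scons : core.

(** An abstraction is harmless as continuation only for a chain of applications, where it ends up as
    the last argument of x V K; a value would be fed to it and a mu would substitute it, perhaps
    into head position. This is why K is a variable unless [garg M] holds. Variable environments
    keep the heads x from becoming abstractions. *)
Lemma good_cps_bnf :
  (forall M, good M = true -> forall so sk, var_env so -> var_env sk ->
    (forall K, bnf K = true -> (exists i, K = lvar i) \/ garg M = true ->
       exists T, bnf T = true /\ lsteps (cps M so sk K) T) /\
    (isval M = true -> exists T, bnf T = true /\ lsteps (star M so sk) T)) /\
  (forall J, goodj J = true -> forall so sk, var_env so -> var_env sk ->
    exists T, bnf T = true /\ lsteps (cpsj J so sk) T).
Proof.
  apply tm_jmp_ind.
  - intros n _ so sk Ho Hk. destruct (Ho n) as [i Hi]. split.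
    + intros K HK [[j ->]|H]; [|discriminate]. simpl. rewrite Hi.
      exists (lapp (lvar j) (lvar i)). split; [reflexivity | apply rt_refl].
    + intros _. simpl. rewrite Hi. exists (lvar i). split; [reflexivity | apply rt_refl].
  - intros B IH HB so sk Ho Hk.
    assert (H : exists T, bnf T = true /\ lsteps (star (Lam B) so sk) T).
    { simpl. rewrite !shf2_shf.
      destruct (IH HB (scons (lvar 1) (shf (shf so))) (shf (shf sk))) as [H _]; auto.
      destruct (H (lvar 0)) as (T & HT & HR); eauto.
      exists (llam (llam T)). split; [exact HT | do 2 apply lsteps_lam; exact HR]. }
    split; [|auto]. intros K HK [[j ->]|E]; [|discriminate].
    rewrite cps_value by reflexivity. destruct H as (T & HT & HR).
    exists (lapp (lvar j) T). split; [exact HT | apply lsteps_app; [apply rt_refl | exact HR]].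
  - intros A _ B IHB H so sk Ho Hk. simpl in H. rewrite !Bool.andb_true_iff in H.
    destruct H as [[HA HvB] HB]. destruct A as [n| | | |]; try discriminate.
    split; [|discriminate]. intros K HK _. simpl. rewrite HvB.
    destruct (Ho n) as [i ->].
    destruct (IHB HB _ _ Ho Hk) as [_ IH]. destruct (IH HvB) as (T & HT & HR).
    exists (lapp (lapp (lvar i) T) K). split.
    + rewrite !bnf_app. auto.
    + repeat apply lsteps_app; auto using rt_refl; apply rt_refl.
  - intros L IHL N IHN H so sk Ho Hk. simpl in H. rewrite !Bool.andb_true_iff in H.
    destruct H as [[HL HN] Hg]. split; [|discriminate]. intros K HK HKg. simpl.
    destruct (IHL HL (scons (lvar 0) (shf so)) (shf sk)) as [H _]; auto.
    destruct (H (lsh K)) as (T & HT & HR).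
    { unfold lsh. rewrite bnf_lren. exact HK. }
    { destruct HKg as [[i ->]|HKg]; [left; eexists; reflexivity|].
      simpl in HKg. rewrite Bool.andb_true_iff in HKg. tauto. }
    destruct (IHN HN so sk) as [H' _]; auto.
    destruct (H' (llam T)) as (T' & HT' & HR'); auto.
    (* The continuation is normalized before N is, as the induction hypothesis on N concerns
       beta-normal continuations. *)
    exists T'. split; [exact HT'|]. eapply rt_trans; [|exact HR'].
    apply lsteps_map with (f := cps N so sk); [intros; apply lstep_cps_cont; assumption|].
    apply lsteps_lam, HR.
  - intros J IH HJ so sk Ho Hk. split; [|discriminate].
    intros K HK [[i ->]|E]; [|discriminate].
    destruct (IH HJ so (scons (lvar i) sk)) as (T & HT & HR); auto.
    exists T. split; [exact HT|]. eapply rt_trans; [apply rt_step, cps_mu_step | exact HR].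
  - intros k M IH HM so sk Ho Hk. destruct (IH HM _ _ Ho Hk) as [H _].
    destruct (Hk k) as [i Hi]. apply H; [rewrite Hi; reflexivity | eauto].
  - intros J IHJ N IHN H so sk Ho Hk. simpl in H. rewrite !Bool.andb_true_iff in H.
    destruct H as [[HL HN] Hg]. simpl.
    destruct (IHJ HL (scons (lvar 0) (shf so)) (shf sk)) as (T & HT & HR); auto.
    destruct (IHN HN so sk) as [H' _]; auto.
    destruct (H' (llam T)) as (T' & HT' & HR'); auto.
    exists T'. split; [exact HT'|]. eapply rt_trans; [|exact HR'].
    apply lsteps_map with (f := cps N so sk); [intros; apply lstep_cps_cont; assumption|].
    apply lsteps_lam, HR.
Qed.

Lemma normalizable_has_nf (M : tm) : normalizable M -> has_nf (cps_top M).
Proof.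
  intros (N & HMN & HN). unfold cps_top.
  set (so := fun n => lvar (S (2 * n))). set (sk := fun n => lvar (S (S (2 * n)))).
  destruct (proj1 good_cps_bnf N (src_normal_good _ HN) so sk) as [H _];
    try (intro; eexists; reflexivity).
  destruct (H (lvar 0)) as (T & HT & HR); eauto.
  apply has_nf_conv with (llam T); [|apply bnf_has_nf, HT].
  apply conv_lam. eapply rst_trans; [apply reds_sound, HMN|].
  apply clos_rt_clos_rst, HR.
Qed.

(** * Size and normalization of good terms *)

Fixpoint size (M : tm) : nat :=
  match M with
  | Var _ => 1
  | Lam B => S (size B)
  | App A B => S (size A + size B)
  | Wh L N => S (size L + size N)
  | Mu J => S (sizej J)
  end
with sizej (J : jmp) : nat :=
  match J with
  | Jmp _ M => S (size M)
  | JWh J' N => S (sizej J' + size N)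
  end.

Lemma is_var_oren (f : nat -> nat) (M : tm) : is_var (oren f M) = is_var M.
Proof. destruct M; reflexivity. Qed.

Lemma is_var_cren (f : nat -> nat) (M : tm) : is_var (cren f M) = is_var M.
Proof. destruct M; reflexivity. Qed.

Lemma garg_oren (M : tm) : forall f, garg (oren f M) = garg M.
Proof. induction M; intro f; simpl; rewrite ?IHM1, ?IHM2; reflexivity. Qed.

Lemma garg_cren (M : tm) : forall f, garg (cren f M) = garg M.
Proof. induction M; intro f; simpl; rewrite ?IHM1, ?IHM2; reflexivity. Qed.

Lemma good_oren_mut :
  (forall M f, good (oren f M) = good M /\ size (oren f M) = size M) /\
  (forall J f, goodj (orenj f J) = goodj J /\ sizej (orenj f J) = sizej J).
Proof.
  apply tm_jmp_ind; intros; simpl; rewrite ?is_var_oren, ?isval_oren, ?garg_oren;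
    repeat match goal with H : forall f, _ /\ _ |- _ =>
      pose proof (fun f => proj1 (H f)); pose proof (fun f => proj2 (H f)); clear H end;
    repeat match goal with H : forall f : nat -> nat, _ |- _ => rewrite H; clear H end; auto.
Qed.

Lemma good_cren_mut :
  (forall M f, good (cren f M) = good M /\ size (cren f M) = size M) /\
  (forall J f, goodj (crenj f J) = goodj J /\ sizej (crenj f J) = sizej J).
Proof.
  apply tm_jmp_ind; intros; simpl; rewrite ?is_var_cren, ?isval_cren, ?garg_cren;
    repeat match goal with H : forall f, _ /\ _ |- _ =>
      pose proof (fun f => proj1 (H f)); pose proof (fun f => proj2 (H f)); clear H end;
    repeat match goal with H : forall f : nat -> nat, _ |- _ => rewrite H; clear H end; auto.
Qed.

Lemma good_oren (f : nat -> nat) (M : tm) : good (oren f M) = good M.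
Proof. apply good_oren_mut. Qed.

Lemma goodj_orenj (f : nat -> nat) (J : jmp) : goodj (orenj f J) = goodj J.
Proof. apply good_oren_mut. Qed.

Lemma good_cren (f : nat -> nat) (M : tm) : good (cren f M) = good M.
Proof. apply good_cren_mut. Qed.

Lemma goodj_crenj (f : nat -> nat) (J : jmp) : goodj (crenj f J) = goodj J.
Proof. apply good_cren_mut. Qed.

Lemma size_oren (f : nat -> nat) (M : tm) : size (oren f M) = size M.
Proof. apply good_oren_mut. Qed.

Lemma sizej_orenj (f : nat -> nat) (J : jmp) : sizej (orenj f J) = sizej J.
Proof. apply good_oren_mut. Qed.

Lemma size_cren (f : nat -> nat) (M : tm) : size (cren f M) = size M.
Proof. apply good_cren_mut. Qed.

Lemma sizej_crenj (f : nat -> nat) (J : jmp) : sizej (crenj f J) = sizej J.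
Proof. apply good_cren_mut. Qed.

(** Each axiom only rearranges the nodes of the term, and [garg] is a conjunction along a
    where-chain, hence insensitive to regrouping by (E1). *)
Lemma good_ec :
  (forall M N, ec M N -> good M = good N /\ size M = size N /\ garg M = garg N /\
     isval M = isval N /\ is_var M = is_var N) /\
  (forall J J', ecj J J' -> goodj J = goodj J' /\ sizej J = sizej J').
Proof.
  apply ec_ecj_ind; simpl; intros;
    repeat match goal with H : _ /\ _ |- _ => destruct H end.
  all: try match goal with e : eax _ _ |- _ => destruct e | e : eaxj _ _ |- _ => destruct e end.
  all: simpl; unfold clift; rewrite ?good_oren, ?good_cren, ?size_oren, ?size_cren,
    ?garg_oren, ?garg_cren, ?goodj_orenj, ?sizej_orenj.
  all: repeat split; try lia; try btauto; congruence.
Qed.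

Lemma teq_good (M N : tm) : teq M N -> good M = good N /\ size M = size N.
Proof.
  induction 1 as [M N H| | |]; try (intuition congruence).
  destruct (proj1 good_ec M N H) as (? & ? & _). auto.
Qed.

(** The last two clauses for terms maintain the side conditions that [good] puts on the argument of
    an enclosing where or application. *)
Lemma good_step :
  (forall M N, step M N -> good M = true -> good N = true /\ size N < size M /\
     (garg M = true -> garg N = true) /\ (isval M = true -> isval N = true)) /\
  (forall J J', stepj J J' -> goodj J = true -> goodj J' = true /\ sizej J' < sizej J).
Proof.
  apply step_stepj_ind.
  - intros M N [P Q HP|V P HV HP|P V HV|P V HV|P J|V HV|P|P] H; simpl in H;
      rewrite ?Bool.andb_true_iff in H.
    + destruct P; intuition discriminate.
    + intuition congruence.
    + intuition discriminate.
    + destruct V; intuition discriminate.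
    + intuition discriminate.
    + destruct V; try (intuition discriminate). simpl. repeat split; auto; lia.
    + simpl. repeat split; [tauto | lia | tauto | discriminate].
    + unfold clift in *. rewrite good_cren in H. simpl. rewrite size_cren.
      repeat split; [tauto | lia | discriminate | discriminate].
  - intros M N _ IH H. simpl in *. destruct (IH H) as (? & ? & _).
    repeat split; auto; lia.
  - intros M M' N Hs _ H. simpl in H. destruct M; try discriminate. inversion Hs.
    inversion H0.
  - intros M N N' _ IH H. simpl in H. rewrite !Bool.andb_true_iff in H.
    destruct H as [[H1 H2] H3]. destruct (IH H3) as (H4 & ? & _ & H5). simpl.
    rewrite H1, H4, H5 by assumption. repeat split; auto; lia.
  - intros L L' N _ IH H. simpl in H. rewrite !Bool.andb_true_iff in H.
    destruct H as [[H1 H2] H3]. destruct (IH H1) as (H4 & ? & H5 & _). simpl.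
    rewrite H4, H2, H3. repeat split; auto; try lia.
    rewrite !Bool.andb_true_iff. tauto.
  - intros L N N' _ IH H. simpl in H. rewrite !Bool.andb_true_iff in H.
    destruct H as [[H1 H2] H3]. destruct (IH H2) as (H4 & ? & H5 & _). simpl.
    rewrite H1, H4, H5 by assumption. repeat split; auto; try lia.
    rewrite !Bool.andb_true_iff. tauto.
  - intros J J' _ IH H. destruct (IH H) as (? & ?). simpl.
    repeat split; auto; try lia; discriminate.
  - intros J J' [l J0] H. unfold csubst0. simpl in *.
    rewrite goodj_crenj, sizej_crenj. split; [exact H | lia].
  - intros k M M' _ IH H. destruct (IH H) as (? & ? & _). simpl. split; auto; lia.
  - intros J J' N _ IH H. simpl in H. rewrite !Bool.andb_true_iff in H.
    destruct H as [[H1 H2] H3]. destruct (IH H1) as (H4 & ?). simpl.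
    rewrite H4, H2, H3. split; auto; lia.
  - intros J N N' _ IH H. simpl in H. rewrite !Bool.andb_true_iff in H.
    destruct H as [[H1 H2] H3]. destruct (IH H2) as (H4 & ? & H5 & _). simpl.
    rewrite H1, H4, H5 by assumption. split; auto; lia.
Qed.

Lemma good_normalizable (M : tm) : good M = true -> normalizable M.
Proof.
  remember (size M) as n eqn:E. revert M E.
  induction n as [n IH] using lt_wf_ind. intros M -> HM.
  destruct (classic (exists N, red M N)) as [(N & HN)|Hn].
  - assert (H : good N = true /\ size N < size M).
    { destruct HN as (M1 & N1 & H1 & H2 & H3).
      apply teq_good in H1 as [G1 S1]. apply teq_good in H3 as [G3 S3].
      rewrite G1 in HM. destruct (proj1 good_step _ _ H2 HM) as (? & ? & _).
      rewrite <- G3, <- S3, S1. auto. }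
    destruct H as [HG HS]. destruct (IH _ HS _ eq_refl HG) as (P & ? & ?).
    exists P. split; [eapply rt_trans; [apply rt_step|]; eassumption | assumption].
  - exists M. split; [apply rt_refl | exact Hn].
Qed.

(** * Reduction up to the congruence *)

(** A [red] always contains a genuine step, whereas a target step may have to be answered by the
    congruence alone. *)
Definition ered (M N : tm) : Prop := teq M N \/ red M N.
Notation ereds := (clos_refl_trans tm ered).

(** A leading congruence is absorbed by the next [red]; if none follows, normality is itself
    invariant under the congruence. *)
Lemma ereds_normalizable (M N : tm) : ereds M N -> normalizable N -> normalizable M.
Proof.
  intro H. apply clos_rt_rt1n in H. induction H as [M|M P N [H|H] _ IH]; intro HN.
  - exact HN.
  - destruct (IH HN) as (Q & HQ & Hn). apply clos_rt_rt1n in HQ.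
    destruct HQ as [|Q1 Q HQ1 HQ].
    + exists M. split; [apply rt_refl|]. intros (Q & HQ). apply Hn. exists Q.
      eapply red_teq_l; [apply rst_sym, H | exact HQ].
    + exists Q. split; [|exact Hn]. eapply rt_trans; [|apply clos_rt1n_rt, HQ].
      apply rt_step. eapply red_teq_l; eassumption.
  - destruct (IH HN) as (Q & HQ & Hn). exists Q. split; [|exact Hn].
    eapply rt_trans; [apply rt_step, H | exact HQ].
Qed.

Lemma ereds_teq (M N : tm) : teq M N -> ereds M N.
Proof. intro H. apply rt_step. left. exact H. Qed.

Lemma ereds_top (M N : tm) : rtop M N -> ereds M N.
Proof. intro H. apply rt_step. right. apply red_top, H. Qed.

Lemma ereds_map (f : tm -> tm) :
  (forall M N, ec M N -> ec (f M) (f N)) -> (forall M N, red M N -> red (f M) (f N)) ->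
  forall M N, ereds M N -> ereds (f M) (f N).
Proof.
  intros He Hr M N. induction 1 as [M N [H|H]|M|].
  - apply ereds_teq. eapply rst_map; eassumption.
  - apply rt_step. right. auto.
  - apply rt_refl.
  - eapply rt_trans; eassumption.
Qed.

Lemma ereds_lam (M N : tm) : ereds M N -> ereds (Lam M) (Lam N).
Proof. apply ereds_map; intros; [apply ec_lam | apply red_lam]; assumption. Qed.

Lemma ereds_app (M M' N N' : tm) :
  ereds M M' -> ereds N N' -> ereds (App M N) (App M' N').
Proof.
  intros HM HN. apply rt_trans with (App M' N).
  - revert HM. apply (ereds_map (fun M => App M N));
      intros; [apply ec_appl | apply red_appl]; assumption.
  - revert HN. apply ereds_map; intros; [apply ec_appr | apply red_appr]; assumption.
Qed.

Lemma ereds_wh (L L' N N' : tm) :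
  ereds L L' -> ereds N N' -> ereds (Wh L N) (Wh L' N').
Proof.
  intros HL HN. apply rt_trans with (Wh L' N).
  - revert HL. apply (ereds_map (fun L => Wh L N));
      intros; [apply ec_whl | apply red_whl]; assumption.
  - revert HN. apply ereds_map; intros; [apply ec_whr | apply red_whr]; assumption.
Qed.

Lemma ereds_mu_jmp (k : nat) (M N : tm) :
  ereds M N -> ereds (Mu (Jmp k M)) (Mu (Jmp k N)).
Proof.
  apply (ereds_map (fun M => Mu (Jmp k M))); intros;
    [apply ec_mu, ecj_jmp | apply red_mu, redj_jmp]; assumption.
Qed.

(** * Source terms simulating target terms *)

(* A nondeterministic CPS translation whose graph is closed under target
   reduction.  [simC so sk M K q] says that [q] is an image of [M] with
   continuation [K].  In [simT_abs] the abstracted continuation is not in the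
   range of the environments, so that [M] represents mu k.[k]M. *)
Inductive simW : (nat -> lt) -> (nat -> lt) -> tm -> lt -> Prop :=
| simW_var : forall so sk n, simW so sk (Var n) (so n)
| simW_lam : forall so sk M t,
    simT (scons (lvar 0) (shf so)) (shf sk) M t -> simW so sk (Lam M) (llam t)
with simT : (nat -> lt) -> (nat -> lt) -> tm -> lt -> Prop :=
| simT_app : forall so sk V1 V2 w1 w2,
    simW so sk V1 w1 -> simW so sk V2 w2 -> simT so sk (App V1 V2) (lapp w1 w2)
| simT_abs : forall so sk M q,
    simC (shf so) (shf sk) M (lvar 0) q -> simT so sk M (llam q)
| simT_mu : forall so sk k M q,
    simC (shf so) (scons (lvar 0) (shf sk)) M (scons (lvar 0) (shf sk) k) q ->
    simT so sk (Mu (Jmp k M)) (llam q)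
with simC : (nat -> lt) -> (nat -> lt) -> tm -> lt -> lt -> Prop :=
| simC_val : forall so sk V w K, simW so sk V w -> simC so sk V K (lapp K w)
| simC_tm : forall so sk M t K, simT so sk M t -> simC so sk M K (lapp t K)
| simC_wh : forall so sk L N K q1 q,
    simC so sk N (llam q1) q ->
    simC (scons (lvar 0) (shf so)) (shf sk) L (lsh K) q1 ->
    simC so sk (Wh L N) K q.

Scheme simW_mut := Induction for simW Sort Prop
with simT_mut := Induction for simT Sort Prop
with simC_mut := Induction for simC Sort Prop.
Combined Scheme sim_ind from simW_mut, simT_mut, simC_mut.

Lemma simW_isval (so sk : nat -> lt) (V : tm) (w : lt) : simW so sk V w -> isval V = true.
Proof. destruct 1; reflexivity. Qed.

(** * Renaming and substitution along the simulation *)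

Lemma oren_id_mut :
  (forall M, oren (fun n => n) M = M) /\ (forall J, orenj (fun n => n) J = J).
Proof. apply tm_jmp_ind; intros; simpl; rewrite ?upr_id; congruence. Qed.

Lemma cren_id_mut :
  (forall M, cren (fun n => n) M = M) /\ (forall J, crenj (fun n => n) J = J).
Proof. apply tm_jmp_ind; intros; simpl; rewrite ?upr_id; congruence. Qed.

Lemma oren_id (M : tm) : oren (fun n => n) M = M.
Proof. apply oren_id_mut. Qed.

Lemma cren_id (M : tm) : cren (fun n => n) M = M.
Proof. apply cren_id_mut. Qed.

Lemma ups_var : ups Var = Var.
Proof. env_ext. reflexivity. Qed.

Lemma osub_id_mut :
  (forall M, osub Var M = M) /\ (forall J, osubj Var J = J).
Proof.
  apply tm_jmp_ind; intros; simpl; rewrite ?ups_var; try congruence.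
  f_equal. assumption.
Qed.

Lemma osub_id (M : tm) : osub Var M = M.
Proof. apply osub_id_mut. Qed.

Definition ren_env (f r : nat -> nat) (s s' : nat -> lt) : Prop :=
  forall n, s' (r n) = lren f (s n).

Lemma ren_env_shf f r s s' : ren_env f r s s' -> ren_env (upr f) r (shf s) (shf s').
Proof. intros H n. unfold shf. rewrite H, lren_upr_lsh. reflexivity. Qed.

Lemma ren_env_scons f r s s' :
  ren_env f r s s' -> ren_env (upr f) (upr r) (scons (lvar 0) (shf s)) (scons (lvar 0) (shf s')).
Proof. intros H [|n]; [reflexivity|]. apply ren_env_shf, H. Qed.

Local Hint Resolve ren_env_shf ren_env_scons : core.

Lemma sim_ren :
  (forall so sk V w, simW so sk V w -> forall f ro rk so' sk',
     ren_env f ro so so' -> ren_env f rk sk sk' ->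
     simW so' sk' (cren rk (oren ro V)) (lren f w)) /\
  (forall so sk M t, simT so sk M t -> forall f ro rk so' sk',
     ren_env f ro so so' -> ren_env f rk sk sk' ->
     simT so' sk' (cren rk (oren ro M)) (lren f t)) /\
  (forall so sk M K q, simC so sk M K q -> forall f ro rk so' sk',
     ren_env f ro so so' -> ren_env f rk sk sk' ->
     simC so' sk' (cren rk (oren ro M)) (lren f K) (lren f q)).
Proof.
  apply sim_ind; intros; simpl.
  - rewrite <- H. constructor.
  - constructor. eauto.
  - constructor; eauto.
  - apply simT_abs. apply (H (upr f)); auto.
  - apply simT_mu. rewrite (ren_env_scons _ _ _ _ H1 k). apply (H (upr f)); auto.
  - apply simC_val. auto.
  - apply simC_tm. auto.
  - eapply simC_wh; [apply (H f); auto|]. rewrite <- lren_upr_lsh. auto.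
Qed.

Lemma sim_lren (f : nat -> nat) (so sk so' sk' : nat -> lt) (M : tm) (K q : lt) :
  ren_env f (fun n => n) so so' -> ren_env f (fun n => n) sk sk' ->
  simC so sk M K q -> simC so' sk' M (lren f K) (lren f q).
Proof.
  intros Ho Hk H. rewrite <- (cren_id M), <- (oren_id M).
  eapply sim_ren; eassumption.
Qed.

Lemma simW_olift (a : lt) (so sk : nat -> lt) (V : tm) (w : lt) :
  simW so sk V w -> simW (scons a (shf so)) (shf sk) (olift V) (lsh w).
Proof.
  intro H. unfold olift. rewrite <- (cren_id (oren S V)).
  eapply sim_ren; [exact H | |]; intro; reflexivity.
Qed.

Lemma simW_clift (a : lt) (so sk : nat -> lt) (V : tm) (w : lt) :
  simW so sk V w -> simW (shf so) (scons a (shf sk)) (clift V) (lsh w).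
Proof.
  intro H. unfold clift. rewrite <- (oren_id V).
  eapply sim_ren; [exact H | |]; intro; reflexivity.
Qed.

Lemma simW_lsh (so sk : nat -> lt) (V : tm) (w : lt) :
  simW so sk V w -> simW (shf so) (shf sk) V (lsh w).
Proof.
  intro H. rewrite <- (cren_id V), <- (oren_id V).
  eapply sim_ren; [exact H | |]; intro; reflexivity.
Qed.

Lemma lren_idE (t : lt) : t = lren (fun n => n) t.
Proof. symmetry. apply lren_id. Qed.

Lemma simC_clift (a : lt) (so sk : nat -> lt) (M : tm) (K q : lt) :
  simC so sk M K q -> simC so (scons a sk) (clift M) K q.
Proof.
  intro H. unfold clift. rewrite <- (oren_id M), (lren_idE K), (lren_idE q).
  eapply sim_ren; [exact H | |]; intro; apply lren_idE.
Qed.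

(** The two sorts of variables behave differently: the source has no terms for continuations, so a
    substituted continuation variable merely changes its image in the environment, while an ordinary
    variable is replaced in the source by a value simulating its new image. *)
Lemma sim_sub :
  (forall so sk V w, simW so sk V w -> forall s p so' sk',
     (forall n, simW so' sk' (p n) (lsub s (so n))) -> (forall k, sk' k = lsub s (sk k)) ->
     simW so' sk' (osub p V) (lsub s w)) /\
  (forall so sk M t, simT so sk M t -> forall s p so' sk',
     (forall n, simW so' sk' (p n) (lsub s (so n))) -> (forall k, sk' k = lsub s (sk k)) ->
     simT so' sk' (osub p M) (lsub s t)) /\
  (forall so sk M K q, simC so sk M K q -> forall s p so' sk',
     (forall n, simW so' sk' (p n) (lsub s (so n))) -> (forall k, sk' k = lsub s (sk k)) ->
     simC so' sk' (osub p M) (lsub s K) (lsub s q)).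
Proof.
  assert (Hshf : forall s sk sk', (forall k : nat, sk' k = lsub s (sk k)) ->
    forall k : nat, shf sk' k = lsub (lups s) (shf sk k)).
  { intros s sk sk' H k. unfold shf. rewrite H, lsub_lups_lsh. reflexivity. }
  assert (Hsc : forall s sk sk', (forall k : nat, sk' k = lsub s (sk k)) ->
    forall k : nat, scons (lvar 0) (shf sk') k = lsub (lups s) (scons (lvar 0) (shf sk) k)).
  { intros s sk sk' H [|k]; [reflexivity|]. apply Hshf, H. }
  assert (Hups : forall s p so so' sk', (forall n, simW so' sk' (p n) (lsub s (so n))) ->
    forall n, simW (scons (lvar 0) (shf so')) (shf sk') (ups p n)
      (lsub (lups s) (scons (lvar 0) (shf so) n))).
  { intros s p so so' sk' H [|n]; simpl.
    - change (lvar 0) with (scons (lvar 0) (shf so') 0) at 2. constructor.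
    - unfold shf at 3. rewrite lsub_lups_lsh. apply simW_olift, H. }
  apply sim_ind; intros; simpl.
  - apply H.
  - constructor. eauto.
  - constructor; eauto.
  - apply simT_abs. apply (H (lups s0)); auto. intro n. unfold shf at 3.
    rewrite lsub_lups_lsh. apply simW_lsh, H0.
  - apply simT_mu. rewrite (Hsc _ _ _ H1 k). apply (H (lups s0)); auto.
    intro n. unfold shf at 3. rewrite lsub_lups_lsh. apply simW_clift, H0.
  - apply simC_val. auto.
  - apply simC_tm. auto.
  - eapply simC_wh; [apply (H s1); auto|]. rewrite <- lsub_lups_lsh. auto.
Qed.

Lemma lsub_scons_shf (u : lt) (s : nat -> lt) (n : nat) :
  lsub (scons u lvar) (shf s n) = s n.
Proof. apply lsub_scons_lsh. Qed.

Lemma simT_osub1 (so sk : nat -> lt) (M V : tm) (t w : lt) :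
  simT (scons (lvar 0) (shf so)) (shf sk) M t -> simW so sk V w ->
  simT so sk (osub (scons V Var) M) (lsub (scons w lvar) t).
Proof.
  intros HM HV. eapply sim_sub; [exact HM | |].
  - intros [|n]; simpl; [exact HV|]. rewrite lsub_scons_shf. constructor.
  - intro k. symmetry. apply lsub_scons_shf.
Qed.

Lemma simC_osub1 (so sk : nat -> lt) (M V : tm) (K q w : lt) :
  simC (scons (lvar 0) (shf so)) (shf sk) M (lsh K) q -> simW so sk V w ->
  simC so sk (osub (scons V Var) M) K (lsub (scons w lvar) q).
Proof.
  intros HM HV. rewrite <- (lsub_scons_lsh w K). eapply sim_sub; [exact HM | |].
  - intros [|n]; simpl; [exact HV|]. rewrite lsub_scons_shf. constructor.
  - intro k. symmetry. apply lsub_scons_shf.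
Qed.

(** With the identity as source substitution, a target substitution is absorbed by the environments.
    Passing a continuation to a mu is expressed in this way. *)
Lemma simC_lsub (s so sk : nat -> lt) (M : tm) (K q : lt) : simC so sk M K q ->
  simC (lsub s >>> so) (lsub s >>> sk) M (lsub s K) (lsub s q).
Proof.
  intro H. rewrite <- (osub_id M). eapply sim_sub; [exact H | |].
  - intro n. apply (simW_var (lsub s >>> so)).
  - reflexivity.
Qed.

Lemma lsub_scons_shfE (u : lt) (s : nat -> lt) : lsub (scons u lvar) >>> shf s = s.
Proof. apply functional_extensionality. intro. apply lsub_scons_shf. Qed.

Lemma lsub_scons_sconsE (u : lt) (s : nat -> lt) :
  lsub (scons u lvar) >>> scons (lvar 0) (shf s) = scons u s.
Proof. env_ext. apply lsub_scons_shf. Qed.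

(** Contracting (\k.q)K where the abstraction comes from [simT_abs] is invisible in the source: M
    stays as it is. *)
Lemma simC_abs_beta (so sk : nat -> lt) (M : tm) (K q : lt) :
  simC (shf so) (shf sk) M (lvar 0) q -> simC so sk M K (lsub (scons K lvar) q).
Proof.
  intro H. apply (simC_lsub (scons K lvar)) in H.
  rewrite !lsub_scons_shfE in H. exact H.
Qed.

Lemma simC_mu_beta (so sk : nat -> lt) (M : tm) (k : nat) (K q : lt) :
  simC (shf so) (scons (lvar 0) (shf sk)) M (scons (lvar 0) (shf sk) k) q ->
  simC so (scons K sk) M (scons K sk k) (lsub (scons K lvar) q).
Proof.
  intro H. apply (simC_lsub (scons K lvar)) in H.
  rewrite lsub_scons_shfE, lsub_scons_sconsE in H.
  replace (scons K sk k) with (lsub (scons K lvar) (scons (lvar 0) (shf sk) k)); [exact H|].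
  rewrite <- (lsub_scons_sconsE K sk). reflexivity.
Qed.

Lemma simC_oren_upr (a : lt) (so sk : nat -> lt) (L : tm) (K q : lt) :
  simC (scons (lvar 0) (shf so)) (shf sk) L (lsh K) q ->
  simC (scons (lvar 0) (shf (scons a (shf so)))) (shf (shf sk))
    (oren (upr S) L) (lsh (lsh K)) (lren (upr S) q).
Proof.
  intro H. rewrite <- (cren_id (oren _ L)), <- (lren_upr_lsh S).
  eapply sim_ren; [exact H | |].
  - intros [|n]; [reflexivity|]. simpl. unfold shf at 3. rewrite lren_upr_lsh. reflexivity.
  - intro k. unfold shf at 3. rewrite lren_upr_lsh. reflexivity.
Qed.

(** The counterpart of [cps_ctxt_mut] for the simulation: a continuation variable bound to \x.q1,
    with q1 an image of L, gets its old image back once the context substitution with L is carried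
    out in the source. *)
Lemma sim_ctxt :
  (forall so sk1 V w, simW so sk1 V w -> forall c L q1 sk,
     sk1 = upd c (llam q1) sk ->
     simC (scons (lvar 0) (shf so)) (shf sk) L (lsh (sk c)) q1 ->
     simW so sk (ctxt c L V) w) /\
  (forall so sk1 M t, simT so sk1 M t -> forall c L q1 sk,
     sk1 = upd c (llam q1) sk ->
     simC (scons (lvar 0) (shf so)) (shf sk) L (lsh (sk c)) q1 ->
     simT so sk (ctxt c L M) t) /\
  (forall so sk1 M K q, simC so sk1 M K q -> forall c L q1 sk,
     sk1 = upd c (llam q1) sk ->
     simC (scons (lvar 0) (shf so)) (shf sk) L (lsh (sk c)) q1 ->
     simC so sk (ctxt c L M) K q).
Proof.
  assert (Hshf : forall c q1 sk, shf (upd c (llam q1) sk) =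
    upd c (llam (lren (upr S) q1)) (shf sk)).
  { intros c q1 sk. exact (eq_sym (upd_shf c (llam q1) sk)). }
  assert (Hshl : forall so sk L K q,
    simC (scons (lvar 0) (shf so)) (shf sk) L (lsh K) q ->
    simC (scons (lvar 0) (shf (shf so))) (shf (shf sk)) L (lsh (lsh K)) (lren (upr S) q)).
  { intros so sk L K q H. rewrite <- (lren_upr_lsh S). revert H. apply sim_lren.
    - intros [|n]; [reflexivity|]. simpl. unfold shf at 3. rewrite lren_upr_lsh. reflexivity.
    - intro k. unfold shf at 3. rewrite lren_upr_lsh. reflexivity. }
  apply sim_ind; intros; subst; simpl.
  - constructor.
  - constructor. eapply H; [apply Hshf | apply simC_oren_upr; assumption].
  - constructor; eauto.
  - apply simT_abs. eapply H; [apply Hshf | apply Hshl; assumption].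
  - assert (HL : simC (scons (lvar 0) (shf (shf so))) (shf (scons (lvar 0) (shf sk0)))
      (clift L) (lsh (lsh (sk0 c))) (lren (upr S) q1)).
    { replace (shf (scons (lvar 0) (shf sk0))) with (scons (lsh (lvar 0)) (shf (shf sk0)))
        by (env_ext; reflexivity).
      apply simC_clift, Hshl, H1. }
    assert (HC : simC (shf so) (scons (lvar 0) (shf sk0)) (ctxt (S c) (clift L) M)
      (scons (lvar 0) (shf (upd c (llam q1) sk0)) k) q).
    { eapply H; [rewrite Hshf, upd_scons; reflexivity | exact HL]. }
    rewrite Hshf, <- upd_scons in HC. unfold upd in HC.
    destruct (Nat.eqb k (S c)) eqn:E; apply simT_mu; [|exact HC].
    apply Nat.eqb_eq in E as ->. eapply simC_wh; [exact HC | exact HL].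
  - apply simC_val. eauto.
  - apply simC_tm. eauto.
  - eapply simC_wh; [eauto|]. eapply H0; [apply Hshf | apply simC_oren_upr; assumption].
Qed.

(** * Strengthening along the simulation *)

Definition inv_env (f r : nat -> nat) (s s0 : nat -> lt) : Prop :=
  forall n y, s n = lren f y -> exists m, n = r m /\ y = s0 m.

Lemma inv_env_shf f r s s0 : inv_env f r s s0 -> inv_env (upr f) r (shf s) (shf s0).
Proof.
  intros H n y E. apply lsh_upr_inv in E as (c & E & ->).
  apply H in E as (m & -> & ->). exists m. auto.
Qed.

Lemma lvar0_inv (f : nat -> nat) (y : lt) : lvar 0 = lren (upr f) y -> y = lvar 0.
Proof.
  destruct y as [n| |]; try discriminate. intro E. injection E as E.
  symmetry in E. apply upr_eq_0 in E as ->. reflexivity.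
Qed.

Lemma inv_env_scons f r s s0 : inv_env f r s s0 ->
  inv_env (upr f) (upr r) (scons (lvar 0) (shf s)) (scons (lvar 0) (shf s0)).
Proof.
  intros H [|n] y E.
  - apply lvar0_inv in E as ->. exists 0. auto.
  - apply (inv_env_shf _ _ _ _ H) in E as (m & -> & ->). exists (S m). auto.
Qed.

Local Hint Resolve inv_env_shf inv_env_scons : core.

(** Every free variable of the source leaves its image in the target term, so a renamed target term
    can only come from a renamed source term. With weakening this yields the non-occurrence
    conditions of [R_eta] and [R_mu]. The continuation occurs in q as well, hence it too is found to
    be renamed. *)
Lemma sim_ren_inv :
  (forall so sk V w, simW so sk V w -> forall f ro rk so0 sk0 w0,
     inv_env f ro so so0 -> inv_env f rk sk sk0 -> w = lren f w0 ->
     exists V0, V = cren rk (oren ro V0) /\ simW so0 sk0 V0 w0) /\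
  (forall so sk M t, simT so sk M t -> forall f ro rk so0 sk0 t0,
     inv_env f ro so so0 -> inv_env f rk sk sk0 -> t = lren f t0 ->
     exists M0, M = cren rk (oren ro M0) /\ simT so0 sk0 M0 t0) /\
  (forall so sk M K q, simC so sk M K q -> forall f ro rk so0 sk0 q0,
     inv_env f ro so so0 -> inv_env f rk sk sk0 -> q = lren f q0 ->
     exists M0 K0, M = cren rk (oren ro M0) /\ K = lren f K0 /\ simC so0 sk0 M0 K0 q0).
Proof.
  apply sim_ind.
  - intros so sk n f ro rk so0 sk0 w0 Ho Hk E. apply Ho in E as (m & -> & ->).
    exists (Var m). split; [reflexivity | constructor].
  - intros so sk M t _ IH f ro rk so0 sk0 w0 Ho Hk E.
    destruct w0 as [|t0|]; try discriminate. injection E as E.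
    destruct (IH (upr f) (upr ro) rk (scons (lvar 0) (shf so0)) (shf sk0) t0)
      as (M0 & -> & ?); auto.
    exists (Lam M0). split; [reflexivity | constructor; assumption].
  - intros so sk V1 V2 w1 w2 _ IH1 _ IH2 f ro rk so0 sk0 t0 Ho Hk E.
    destruct t0 as [| |u1 u2]; try discriminate. injection E as E1 E2.
    destruct (IH1 _ _ _ _ _ _ Ho Hk E1) as (M1 & -> & ?).
    destruct (IH2 _ _ _ _ _ _ Ho Hk E2) as (M2 & -> & ?).
    exists (App M1 M2). split; [reflexivity | constructor; assumption].
  - intros so sk M q _ IH f ro rk so0 sk0 t0 Ho Hk E.
    destruct t0 as [|q0|]; try discriminate. injection E as E.
    destruct (IH (upr f) ro rk (shf so0) (shf sk0) q0) as (M0 & K0 & -> & EK & ?); auto.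
    apply lvar0_inv in EK as ->.
    exists M0. split; [reflexivity | apply simT_abs; assumption].
  - intros so sk k M q _ IH f ro rk so0 sk0 t0 Ho Hk E.
    destruct t0 as [|q0|]; try discriminate. injection E as E.
    destruct (IH (upr f) ro (upr rk) (shf so0) (scons (lvar 0) (shf sk0)) q0)
      as (M0 & K0 & -> & EK & ?); auto.
    apply (inv_env_scons _ _ _ _ Hk) in EK as (k0 & -> & ->).
    exists (Mu (Jmp k0 M0)). split; [reflexivity | apply simT_mu; assumption].
  - intros so sk V w K _ IH f ro rk so0 sk0 q0 Ho Hk E.
    destruct q0 as [| |K0 w0]; try discriminate. injection E as -> E.
    destruct (IH _ _ _ _ _ _ Ho Hk E) as (V0 & -> & ?).
    exists V0, K0. repeat split. apply simC_val. assumption.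
  - intros so sk M t K _ IH f ro rk so0 sk0 q0 Ho Hk E.
    destruct q0 as [| |t0 K0]; try discriminate. injection E as E ->.
    destruct (IH _ _ _ _ _ _ Ho Hk E) as (M0 & -> & ?).
    exists M0, K0. repeat split. apply simC_tm. assumption.
  - intros so sk L N K q1 q _ IHN _ IHL f ro rk so0 sk0 q0 Ho Hk E.
    destruct (IHN _ _ _ _ _ _ Ho Hk E) as (N0 & K0 & -> & EK & ?).
    destruct K0 as [|q10|]; try discriminate. injection EK as EK.
    destruct (IHL (upr f) (upr ro) rk (scons (lvar 0) (shf so0)) (shf sk0) q10)
      as (L0 & K1 & -> & EK1 & ?); auto.
    apply lsh_upr_inv in EK1 as (K0 & -> & ->).
    exists (Wh L0 N0), K0. repeat split. eapply simC_wh; eassumption.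
Qed.

Lemma inv_env_S_shf (s : nat -> lt) : inv_env S (fun n => n) (shf s) s.
Proof. intros n y E. apply lsh_inj in E as <-. exists n. auto. Qed.

Lemma inv_env_S_scons (s : nat -> lt) : inv_env S S (scons (lvar 0) (shf s)) s.
Proof.
  intros [|n] y E; [symmetry in E; apply lsh_lvar0 in E as [] |].
  apply lsh_inj in E as <-. exists n. auto.
Qed.

(** * Simulation of target steps *)

Lemma scons_shf_lvar0 (s : nat -> lt) (n : nat) : scons (lvar 0) (shf s) n = lvar 0 -> n = 0.
Proof. destruct n; [auto|]. intro E. apply lsh_lvar0 in E as []. Qed.

(** Inversion for the body of an eta redex. A where-term is excluded: its argument runs under an
    abstraction, which would have to be A or the variable 0. *)
Lemma simC_app_var0 (so sk : nat -> lt) (M : tm) (K q : lt) : simC so sk M K q ->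
  forall A, q = lapp A (lvar 0) -> is_llam A = false ->
  (A = K /\ simW so sk M (lvar 0)) \/ (K = lvar 0 /\ simT so sk M A).
Proof.
  induction 1 as [so sk V w K HV|so sk M t K HM|so sk L N K q1 q HN IHN HL IHL];
    intros A E HA.
  - injection E as -> ->. auto.
  - injection E as -> ->. auto.
  - destruct (IHN _ E HA) as [[-> _]|[E' _]]; discriminate.
Qed.

(** The ways in which an image of M under K can step. The step may be matched inside M, or lie in K.
    It may pass K to a mu: M then becomes that mu-term, whose jump is described with index 0 bound
    to K, since K is already consumed. Finally K may be an abstraction applied to a value of M; the
    source step then exists only in an enclosing where whose body L is represented by K, hence the
    quantification over L and its continuation K2. *)
Definition outcome (so sk : nat -> lt) (M : tm) (K q : lt) : Prop :=
  (exists M', ereds M M' /\ simC so sk M' K q) \/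
  (exists K', lstep K K' /\ simC so sk M K' q) \/
  (exists k M1, ereds M (Mu (Jmp k M1)) /\ simC so (scons K sk) M1 (scons K sk k) q) \/
  (exists q1, K = llam q1 /\ forall L K2,
     simC (scons (lvar 0) (shf so)) (shf sk) L (lsh K2) q1 ->
     exists M2, ereds (Wh L M) M2 /\ simC so sk M2 K2 q).

(** An eta step whose result is an abstraction is also a beta step of the body and is counted as
    such. The eta case proper may then assume that the result is no abstraction, as [simC_app_var0]
    requires. *)
Lemma lstep_llam_inv (q t : lt) : lstep (llam q) t ->
  (exists q', lstep q q' /\ t = llam q') \/
  (q = lapp (lsh t) (lvar 0) /\ is_llam t = false).
Proof.
  intro H. inversion H as [|F E|? q' Hq| |]; subst; [|eauto].
  destruct t as [|t0|]; auto. left. exists t0. split; [|reflexivity].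
  rewrite <- (lsub_upr_S_lvar0 t0) at 2. apply l_beta.
Qed.

Lemma lvar_lstep (s : nat -> lt) (n : nat) (t : lt) : var_env s -> ~ lstep (s n) t.
Proof. intros H. destruct (H n) as [i ->]. intro Hs. inversion Hs. Qed.

Lemma var_env_not_llam (s : nat -> lt) (n : nat) (t : lt) : var_env s -> s n <> llam t.
Proof. intros H. destruct (H n) as [i ->]. discriminate. Qed.

Lemma simW_lvar_inv (so sk : nat -> lt) (V : tm) (i : nat) :
  simW so sk V (lvar i) -> exists n, V = Var n /\ so n = lvar i.
Proof. intro H. inversion H; subst. eauto. Qed.

Lemma simW_llam_inv (so sk : nat -> lt) (V : tm) (t : lt) : var_env so ->
  simW so sk V (llam t) ->
  exists M, V = Lam M /\ simT (scons (lvar 0) (shf so)) (shf sk) M t.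
Proof.
  intros Ho H. remember (llam t) as w eqn:E. destruct H as [so sk n|so sk M t' HM].
  - apply var_env_not_llam in E as []. exact Ho.
  - injection E as ->. eauto.
Qed.

(** By [R_whMu] the mu in argument position takes the where-context into its jumps, and [sim_ctxt]
    accordingly rebinds its variable from \x.q1 to K. *)
Lemma outcome_where_jump (so sk : nat -> lt) (L N N1 : tm) (k : nat) (K q1 q : lt) :
  ereds N (Mu (Jmp k N1)) ->
  simC so (scons (llam q1) sk) N1 (scons (llam q1) sk k) q ->
  simC (scons (lvar 0) (shf so)) (shf sk) L (lsh K) q1 ->
  outcome so sk (Wh L N) K q.
Proof.
  intros HN HC HL. right; right; left.
  assert (HL' : simC (scons (lvar 0) (shf so)) (shf (scons K sk)) (clift L) (lsh K) q1).
  { replace (shf (scons K sk)) with (scons (lsh K) (shf sk)) by (env_ext; reflexivity).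
    apply simC_clift, HL. }
  assert (HC' : simC so (scons K sk) (ctxt 0 (clift L) N1) (scons (llam q1) sk k) q).
  { eapply sim_ctxt; [exact HC | | exact HL']. env_ext. reflexivity. }
  assert (HR : ereds (Wh L N) (Mu (ctxj 0 (clift L) (Jmp k N1)))).
  { eapply rt_trans; [apply ereds_wh; [apply rt_refl | exact HN]|].
    apply ereds_top, R_whMu. }
  (* The outermost jump is itself affected by the context substitution exactly when it goes to index
     0. *)
  destruct k as [|k]; simpl in HR.
  - eexists _, _. split; [exact HR|]. eapply simC_wh; [exact HC' | exact HL'].
  - eexists _, _. split; [exact HR | exact HC'].
Qed.

(** With variables as environments, the images of variables contain no redex and are no
    abstractions, so every redex of the target term is accounted for by the rules of the
    simulation. *)
Lemma sim_step :
  (forall so sk V w, simW so sk V w -> var_env so -> var_env sk ->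
     forall w', lstep w w' -> exists V', ereds V V' /\ simW so sk V' w') /\
  (forall so sk M t, simT so sk M t -> var_env so -> var_env sk ->
     forall t', lstep t t' -> exists M', ereds M M' /\ simT so sk M' t') /\
  (forall so sk M K q, simC so sk M K q -> var_env so -> var_env sk ->
     forall q', lstep q q' -> outcome so sk M K q').
Proof.
  apply sim_ind.
  - intros so sk n Ho Hk w' Hs. apply lvar_lstep in Hs as []. exact Ho.
  - intros so sk M t HM IH Ho Hk w' Hs.
    apply lstep_llam_inv in Hs as [(t' & Hs & ->)|[-> HF]].
    + destruct (IH (var_env_scons _ _ (var_env_shf _ Ho)) (var_env_shf _ Hk) _ Hs)
        as (M' & HR & HM').
      exists (Lam M'). split; [apply ereds_lam, HR | constructor; exact HM'].
    (* The body is a target application, so the source is \x.V1 x, and strengthening shows that x is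
       not free in V1. *)
    + inversion HM as [? ? V1 V2 w1 w2 H1 H2| |]; subst.
      apply simW_lvar_inv in H2 as (n & -> & E). apply scons_shf_lvar0 in E as ->.
      destruct (proj1 sim_ren_inv _ _ _ _ H1 S S (fun n => n) so sk w')
        as (V0 & -> & HV0); auto using inv_env_S_scons, inv_env_S_shf.
      exists V0. rewrite cren_id. split; [|exact HV0].
      apply ereds_top, R_eta. eapply simW_isval, HV0.
  - intros so sk V1 V2 w1 w2 H1 IH1 H2 IH2 Ho Hk t' Hs.
    inversion Hs as [B N E| | |A A' B Hs1|A B B' Hs2]; subst.
    + apply simW_llam_inv in H1 as (M & -> & HM); [|exact Ho].
      exists (osub (scons V2 Var) M). split; [|apply simT_osub1; assumption].
      apply simW_isval in H2.
      (* One target beta step is two source steps: the argument is first named by a where and then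
         substituted. *)
      eapply rt_trans; [apply ereds_top, R_beta, H2 | apply ereds_top, R_whV, H2].
    + destruct (IH1 Ho Hk _ Hs1) as (V & HR & HV). exists (App V V2).
      split; [apply ereds_app; [exact HR | apply rt_refl] | constructor; assumption].
    + destruct (IH2 Ho Hk _ Hs2) as (V & HR & HV). exists (App V1 V).
      split; [apply ereds_app; [apply rt_refl | exact HR] | constructor; assumption].
  - intros so sk M q HM IH Ho Hk t' Hs.
    apply lstep_llam_inv in Hs as [(q' & Hs & ->)|[-> HF]].
    + destruct (IH (var_env_shf _ Ho) (var_env_shf _ Hk) _ Hs)
        as [(M' & HR & HM')|[(K' & HK & _)|[(k & M1 & HR & HM1)|(q1 & E & _)]]].
      * exists M'. split; [exact HR | apply simT_abs, HM'].
      * inversion HK.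
      (* Here K is the abstracted variable itself, so this outcome is the premise of [simT_mu]: the
         implicit mu k.[k]M merges with the mu of M at no cost. *)
      * eexists. split; [exact HR | apply simT_mu, HM1].
      * discriminate.
    + destruct (simC_app_var0 _ _ _ _ _ HM _ eq_refl) as [[E _]|[_ HT]].
      * unfold lsh. rewrite is_llam_lren. exact HF.
      * apply lsh_lvar0 in E as [].
      * destruct (proj1 (proj2 sim_ren_inv) _ _ _ _ HT S (fun n => n) (fun n => n) so sk t')
          as (M0 & -> & HM0); auto using inv_env_S_shf.
        exists M0. rewrite cren_id, oren_id. split; [apply rt_refl | exact HM0].
  - intros so sk k M q HM IH Ho Hk t' Hs.
    assert (Hk' : var_env (scons (lvar 0) (shf sk)))
      by (apply var_env_scons, var_env_shf, Hk).
    apply lstep_llam_inv in Hs as [(q' & Hs & ->)|[-> HF]].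
    + destruct (IH (var_env_shf _ Ho) Hk' _ Hs)
        as [(M' & HR & HM')|[(K' & HK & _)|[(j & M1 & HR & HM1)|(q1 & E & _)]]].
      * eexists. split; [apply ereds_mu_jmp, HR | apply simT_mu, HM'].
      * apply lvar_lstep in HK as []. exact Hk'.
      (* Two explicit mus are merged by [R_jmu]; [g] is the renaming of [csubst0 k], which
         identifies the inner continuation variable with k. *)
      * set (g := scons k (fun m => m)).
        assert (Hg : forall j, scons (lvar 0) (shf sk) (g j) =
           scons (scons (lvar 0) (shf sk) k) (scons (lvar 0) (shf sk)) j)
          by (intros [|?]; reflexivity).
        exists (Mu (Jmp (g j) (cren g M1))). split.
        -- eapply rt_trans; [apply ereds_mu_jmp, HR|]. apply rt_step. right.
           apply red_step, s_mu, sj_top. exact (R_jmu k (Jmp j M1)).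
        -- apply simT_mu. rewrite Hg. rewrite <- (oren_id M1).
           rewrite (lren_idE q'), (lren_idE (scons _ _ j)).
           eapply sim_ren; [exact HM1 | |]; intro; rewrite lren_id; auto.
      * apply var_env_not_llam in E as []. exact Hk'.
    + destruct (simC_app_var0 _ _ _ _ _ HM _ eq_refl) as [[_ HW]|[E HT]].
      * unfold lsh. rewrite is_llam_lren. exact HF.
      * apply simW_lvar_inv in HW as (n & _ & E). apply lsh_lvar0 in E as [].
      * apply scons_shf_lvar0 in E as ->.
        destruct (proj1 (proj2 sim_ren_inv) _ _ _ _ HT S (fun n => n) S so sk t')
          as (M0 & -> & HM0); auto using inv_env_S_shf, inv_env_S_scons.
        exists M0. rewrite oren_id. split; [apply ereds_top, R_mu | exact HM0].
  - intros so sk V w K HV IH Ho Hk q' Hs.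
    inversion Hs as [q1 N E| | |A K' B Hs1|A B w' Hs2]; subst.
    + right; right; right. exists q1. split; [reflexivity|]. intros L K2 HL.
      exists (osub (scons V Var) L). split; [|apply simC_osub1; assumption].
      apply ereds_top, R_whV. eapply simW_isval, HV.
    + right; left. exists K'. split; [exact Hs1 | apply simC_val, HV].
    + left. destruct (IH Ho Hk _ Hs2) as (V' & HR & HV').
      exists V'. split; [exact HR | apply simC_val, HV'].
  - intros so sk M t K HM IH Ho Hk q' Hs.
    inversion Hs as [q0 N E| | |A t' B Hs1|A B K' Hs2]; subst.
    + inversion HM as [|? ? ? ? HC|? ? k M1 ? HC]; subst.
      * left. exists M. split; [apply rt_refl | apply simC_abs_beta, HC].
      * right; right; left. exists k, M1. split; [apply rt_refl | apply simC_mu_beta, HC].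
    + left. destruct (IH Ho Hk _ Hs1) as (M' & HR & HM').
      exists M'. split; [exact HR | apply simC_tm, HM'].
    + right; left. exists K'. split; [exact Hs2 | apply simC_tm, HM].
  - intros so sk L N K q1 q HN IHN HL IHL Ho Hk q' Hs.
    destruct (IHN Ho Hk _ Hs)
      as [(N' & HR & HN')|[(K' & HK & HN')|[(k & N1 & HR & HN1)|(q2 & E & HW)]]].
    + left. exists (Wh L N').
      split; [apply ereds_wh; [apply rt_refl | exact HR] | eapply simC_wh; eassumption].
    + apply lstep_llam_inv in HK as [(q1' & HK & ->)|[-> HF]].
      * destruct (IHL (var_env_scons _ _ (var_env_shf _ Ho)) (var_env_shf _ Hk) _ HK)
          as [(L' & HR & HL')|[(K' & HK' & HL')|[(k & L1 & HR & HL1)|(q2 & E & HW)]]].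
        -- left. exists (Wh L' N).
           split; [apply ereds_wh; [exact HR | apply rt_refl] | eapply simC_wh; eassumption].
        -- destruct (lstep_lren_inv _ _ HK' _ _ eq_refl) as (K0 & -> & HK0).
           right; left. exists K0. split; [exact HK0 | eapply simC_wh; eassumption].
        (* The body has become a mu: (E2) moves the where under it, and (E3) moves the where under
           the bracket. *)
        -- right; right; left. exists k, (Wh L1 (clift N)). split.
           ++ eapply rt_trans; [apply ereds_wh; [exact HR | apply rt_refl]|].
              apply ereds_teq. eapply rst_trans; [apply rst_step, ec_ax, E2|].
              apply teq_mu, rst_sym, rst_step, ecj_ax, E3.
           ++ eapply simC_wh; [apply simC_clift, HN'|].
              replace (shf (scons K sk)) with (scons (lsh K) (shf sk))
                by (env_ext; reflexivity).
              replace (lsh (scons K sk k)) with (scons (lsh K) (shf sk) k)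
                by (destruct k; reflexivity).
              exact HL1.
        (* The value belongs to L and its continuation to a where further out. (E1) makes that outer
           where act directly on L, with its body weakened past x. *)
        -- apply lsh_llam_inv in E as (q3 & -> & ->).
           right; right; right. exists q3. split; [reflexivity|]. intros L2 K2 HL2.
           destruct (HW (oren (upr S) L2) (lsh K2)) as (M2 & HR & HM2).
           { apply simC_oren_upr, HL2. }
           exists (Wh M2 N). split; [|eapply simC_wh; eassumption].
           eapply rt_trans; [apply ereds_teq, rst_step, ec_ax, E1|].
           apply ereds_wh; [exact HR | apply rt_refl].
      * destruct (simC_app_var0 _ _ _ _ _ HL _ eq_refl) as [[E HV]|[E _]].
        -- unfold lsh. rewrite is_llam_lren. exact HF.
        (* The continuation \x.K x was an eta redex, so the body of the where is its own variable
           and [R_whx] applies. *)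
        -- apply lsh_inj in E as ->. apply simW_lvar_inv in HV as (n & -> & E).
           apply scons_shf_lvar0 in E as ->.
           left. exists N. split; [apply ereds_top, R_whx | exact HN'].
        -- apply lsh_lvar0 in E as [].
    + eapply outcome_where_jump; eassumption.
    + injection E as <-. left. exact (HW _ _ HL).
Qed.

Lemma sim_steps (so sk : nat -> lt) (t t' : lt) : var_env so -> var_env sk ->
  lsteps t t' -> forall M, simT so sk M t -> exists M', ereds M M' /\ simT so sk M' t'.
Proof.
  intros Ho Hk. induction 1 as [t t' Hs|t|t u v _ IH1 _ IH2]; intros M HM.
  - eapply sim_step; eassumption.
  - exists M. split; [apply rt_refl | exact HM].
  - destruct (IH1 _ HM) as (P & HR1 & HP). destruct (IH2 _ HP) as (Q & HR2 & HQ).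
    exists Q. split; [eapply rt_trans; eassumption | exact HQ].
Qed.

(** The condition of [good_cps_bnf] read backwards: in a beta-normal image an abstraction used as
    continuation is never in head position, so it must be the last argument of an application image,
    and this forces [garg]. *)
Lemma sim_bnf_good :
  (forall so sk V w, simW so sk V w -> bnf w = true -> good V = true) /\
  (forall so sk M t, simT so sk M t -> bnf t = true -> good M = true) /\
  (forall so sk M K q, simC so sk M K q -> bnf q = true ->
     good M = true /\ bnf K = true /\ (is_llam K = true -> garg M = true)).
Proof.
  apply sim_ind.
  - reflexivity.
  - intros so sk M t _ IH H. exact (IH H).
  - intros so sk V1 V2 w1 w2 H1 _ H2 IH2 H. apply bnf_app in H as (Hl & _ & H).
    simpl. rewrite (simW_isval _ _ _ _ H2), (IH2 H).
    destruct H1; [reflexivity | discriminate].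
  - intros so sk M q _ IH H. exact (proj1 (IH H)).
  - intros so sk k M q _ IH H. exact (proj1 (IH H)).
  - intros so sk V w K HV IH H. apply bnf_app in H as (Hl & HK & H).
    rewrite Hl. repeat split; auto. discriminate.
  - intros so sk M t K HM IH H. apply bnf_app in H as (Hl & Ht & HK).
    repeat split; auto. intros _. destruct HM; try discriminate. reflexivity.
  - intros so sk L N K q1 q _ IHN _ IHL H.
    destruct (IHN H) as (HN & H1 & HgN). destruct (IHL H1) as (HL & H2 & HgL).
    unfold lsh in *. rewrite bnf_lren in H2. rewrite is_llam_lren in HgL. simpl.
    rewrite HL, HN, HgN by reflexivity. repeat split; auto.
    intro HK. rewrite (HgL HK). reflexivity.
Qed.

(** The simulation relates applications of values and jumps of the form [k]M, so M is first
    prepared: non-value operands are named by [R_appN] and [R_appV], and jumps are regrouped by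
    (E3). Preservation of [isval] ensures that the prepared operands call for the same rules as the
    original ones. *)
Lemma cps_sim_mut :
  (forall M, exists M1, ereds M M1 /\ isval M1 = isval M /\
     (forall so sk K, simC so sk M1 K (cps M so sk K)) /\
     (isval M = true -> forall so sk, simW so sk M1 (star M so sk))) /\
  (forall J, exists M1, ereds (jbody J) M1 /\
     forall so sk, simC so sk M1 (sk (jtail J)) (cpsj J so sk)).
Proof.
  apply tm_jmp_ind.
  - intro n. exists (Var n). split; [apply rt_refl|]. repeat split; intros.
    + apply simC_val, simW_var.
    + apply simW_var.
  - intros B (B1 & HR & _ & HB & _). exists (Lam B1).
    assert (H : forall so sk, simW so sk (Lam B1) (star (Lam B) so sk)).
    { intros. simpl. apply simW_lam, simT_abs. rewrite !shf2_shf.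
      replace (scons (lvar 1) (shf (shf so))) with (shf (scons (lvar 0) (shf so)))
        by (env_ext; reflexivity).
      apply HB. }
    split; [apply ereds_lam, HR|]. repeat split; auto.
    intros. rewrite cps_value by reflexivity. apply simC_val, H.
  - intros A (A1 & RA & VA & CA & SA) B (B1 & RB & VB & CB & SB).
    assert (HR : ereds (App A B) (App A1 B1)) by (apply ereds_app; assumption).
    assert (Hx : forall so sk, simW (scons (lvar 0) (shf so)) sk (Var 0) (lvar 0)).
    { intros so sk. exact (simW_var (scons (lvar 0) (shf so)) sk 0). }
    simpl. destruct (isval A) eqn:EA; [|destruct (isval B) eqn:EB].
    + destruct (isval B) eqn:EB.
      * exists (App A1 B1). split; [exact HR|]. repeat split; [|discriminate].
        intros. apply simC_tm, simT_app; auto.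
      * exists (Wh (App (olift A1) (Var 0)) B1). split.
        { eapply rt_trans; [exact HR | apply ereds_top, R_appV; assumption]. }
        repeat split; [|discriminate]. intros. eapply simC_wh; [apply CB|].
        apply simC_tm, simT_app; [apply simW_olift; auto | apply Hx].
    + exists (Wh (App (Var 0) (olift B1)) A1). split.
      { eapply rt_trans; [exact HR | apply ereds_top, R_appN; assumption]. }
      repeat split; [|discriminate]. intros. eapply simC_wh; [apply CA|].
      apply simC_tm, simT_app; [apply Hx | apply simW_olift; auto].
    (* The function is evaluated first, so its where is outermost; once named it is a variable, and
       [R_appV] can name the argument. *)
    + exists (Wh (Wh (App (Var 1) (Var 0)) (olift B1)) A1). split.
      { eapply rt_trans; [exact HR|].
        eapply rt_trans; [apply ereds_top, R_appN; assumption|].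
        apply ereds_wh; [|apply rt_refl].
        apply ereds_top, (R_appV (Var 0)); [reflexivity|].
        unfold olift. rewrite isval_oren. exact VB. }
      repeat split; [|discriminate]. intros. eapply simC_wh; [apply CA|].
      eapply simC_wh.
      * unfold olift. rewrite <- (cren_id (oren S B1)).
        rewrite (lren_idE (cps B _ _ _)), (lren_idE (llam _)).
        eapply sim_ren; [apply CB | |]; intro; apply lren_idE.
      * rewrite lren2_lsh. apply simC_tm, simT_app.
        -- exact (simW_var (scons (lvar 0) (shf (scons (lvar 0) (shf so)))) _ 1).
        -- apply Hx.
  - intros L (L1 & RL & _ & CL & _) N (N1 & RN & _ & CN & _).
    exists (Wh L1 N1). split; [apply ereds_wh; assumption|].
    repeat split; [|discriminate]. intros. eapply simC_wh; [apply CN | apply CL].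
  - intros J (M1 & HR & HC). exists (Mu (Jmp (jtail J) M1)). split.
    { eapply rt_trans; [apply ereds_teq, teq_mu, teqj_jump | apply ereds_mu_jmp, HR]. }
    repeat split; [|discriminate]. intros. apply simC_tm, simT_mu, HC.
  - intros k M (M1 & HR & _ & HC & _). exists M1. split; [exact HR|]. intros. apply HC.
  - intros J (M1 & RJ & CJ) N (N1 & RN & _ & CN & _).
    exists (Wh M1 N1). split; [apply ereds_wh; assumption|].
    intros. eapply simC_wh; [apply CN | apply (CJ _ (shf sk))].
Qed.

Lemma has_nf_normalizable (M : tm) : has_nf (cps_top M) -> normalizable M.
Proof.
  intros (t & Hs & Hn). destruct (proj1 cps_sim_mut M) as (M1 & HR1 & _ & HC & _).
  (* The environments of [cps_top] before weakening: its outer \k is read by [simT_abs], so no mu is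
     added around M1. *)
  set (so := fun n => lvar (2 * n)). set (sk := fun n => lvar (S (2 * n))).
  assert (HT : simT so sk M1 (cps_top M)) by (apply simT_abs, (HC (shf so) (shf sk))).
  destruct (sim_steps so sk _ _ ltac:(intro; eexists; reflexivity)
    ltac:(intro; eexists; reflexivity) Hs _ HT) as (N & HR & HN).
  apply ereds_normalizable with N; [eapply rt_trans; eassumption|].
  apply good_normalizable. apply (proj1 (proj2 sim_bnf_good) _ _ _ _ HN), lnormal_bnf, Hn.
Qed.

Theorem theorem2p11 : forall M : tm, normalizable M <-> has_nf (cps_top M).
Proof.
  intro M. split; [apply normalizable_has_nf | apply has_nf_normalizable].
Qed.
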